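(* Let $F$ be a field of characteristic zero, $n=n_1+\cdots+n_t$, and let $M_n(F)$ carry the idempotents $e_1,\dots,e_t$ (with $tr(e_a)=n_a$). The ideal of mixed $E$-trace identities of $M_n(F)$ is generated, as an ideal closed under substitution of mixed $E$-trace polynomials for the variables, by the mixed Cayley–Hamilton polynomials restricted to the diagonal components: $$MCH_{n_a+1}(E_aX_1E_a,\ldots,E_aX_{n_a}E_a),\qquad a=1,\dots,t.$$
   Context: $e_a$ is the diagonal idempotent of $M_n(F)$ which is the sum of the matrix units $e_{ii}$ with $i$ in the $a$-th block of indices of size $n_a$; $E$-polynomials and (pure/mixed) $E$-trace polynomials are as follows: $F\langle X,E\rangle$ is the free algebra on $X\cup\{E_1,\dots,E_t\}$ modulo $E_aE_b=\delta_{ab}E_a$, $\sum_aE_a=1$; $E$-trace polynomials add a formal trace (linear, cyclic, central values, $tr(tr(u)v)=tr(u)tr(v)$) with $tr(E_a)=n_a$; pure ones are polynomials in traces of $E$-monomials, mixed ones are combinations of pure ones times $E$-monomials; evaluation sends $E_a\mapsto e_a$. For $\sigma\in S_m$ with $\sigma^{-1}=(i_1,\dots,i_a)(j_1,\dots,j_b)\cdots$ (all cycles, including 1-cycles), $tr_\sigma(x_1,\dots,x_m)=tr(x_{i_1}\cdots x_{i_a})tr(x_{j_1}\cdots x_{j_b})\cdots$. The multilinear Cayley–Hamilton polynomial is $CH_m(x_1,\dots,x_m)=\sum_{\sigma\in S_m}\mathrm{sgn}(\sigma)\,tr_\sigma(x_1,\dots,x_m)$, and the mixed trace polynomial $MCH_m(x_1,\dots,x_{m-1})$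 is defined by $tr(MCH_m(x_1,\dots,x_{m-1})x_m)=CH_m(x_1,\dots,x_m)$.
   Formalization: The generators are taken as E_a·MCH_{n_a+1}(E_aX_1E_a,…,E_aX_{n_a}E_a)·E_a, since without the outer E_a they are not identities when t ≥ 2 (n_1=n_2=1, X=e_1 gives e_2); the ideal generated is also closed under the formal trace. *)

(* Defs.v *)
From HB Require Import structures.
From mathcomp Require Import all_boot all_order all_algebra all_fingroup.
Unset Printing Implicit Defensive.
Import GRing.Theory.
Local Open Scope ring_scope.

(* Syntax of E-trace polynomials over F with t idempotent symbols E_a.    *)
(* Variables x_0, x_1, ... are indexed by nat (paper's X_1,X_2,... are    *)
(* x_0, x_1, ...).  Terms are identified modulo the E-trace algebra axioms *)
(* through the congruence [etrel] below; the quotient is the free algebra *)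
(* of mixed E-trace polynomials.                                          *)
Inductive etm (F : fieldType) (t : nat) : Type :=
| EVar of nat
| EIdem of 'I_t
| EConst of F
| EAdd of etm F t & etm F t
| EMul of etm F t & etm F t
| ETr of etm F t.

Arguments EVar {F t}.
Arguments EIdem {F t}.
Arguments EConst {F t}.
Arguments EAdd {F t}.
Arguments EMul {F t}.
Arguments ETr {F t}.

Definition EZero {F : fieldType} {t : nat} : etm F t := EConst 0.
Definition EOne {F : fieldType} {t : nat} : etm F t := EConst 1.

Definition eprod {F : fieldType} {t : nat} (l : seq (etm F t)) : etm F t :=
  foldr EMul EOne l.
Definition esum {F : fieldType} {t : nat} (l : seq (etm F t)) : etm F t :=
  foldr EAdd EZero l.

Fixpoint esubst {F : fieldType} {t : nat} (s : nat -> etm F t) (u : etm F t)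
  : etm F t :=
  match u with
  | EVar i => s i
  | EIdem a => EIdem a
  | EConst c => EConst c
  | EAdd u v => EAdd (esubst s u) (esubst s v)
  | EMul u v => EMul (esubst s u) (esubst s v)
  | ETr u => ETr (esubst s u)
  end.

(* The congruence generated by the axioms of E-trace algebras (with       *)
(* tr(E_a) = n_a) together with all substitution instances g(s) = 0 of    *)
(* the generators g in G.  [etrel nn G f EZero] says exactly that f lies  *)
(* in the ideal (closed under tr, i.e. a trace ideal) of the free algebra *)
(* of mixed E-trace polynomials generated by all substitution instances   *)
(* of elements of G, i.e. the ideal generated by G and closed under       *)
(* substitution of mixed E-trace polynomials for the variables.           *)
Inductive etrel {F : fieldType} {t : nat} (nn : 'I_t -> nat)
    (G : etm F t -> Prop) : etm F t -> etm F t -> Prop :=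
| er_refl u : etrel nn G u u
| er_sym u v : etrel nn G u v -> etrel nn G v u
| er_trans u v w : etrel nn G u v -> etrel nn G v w -> etrel nn G u w
| er_add u u' v v' : etrel nn G u u' -> etrel nn G v v' ->
    etrel nn G (EAdd u v) (EAdd u' v')
| er_mul u u' v v' : etrel nn G u u' -> etrel nn G v v' ->
    etrel nn G (EMul u v) (EMul u' v')
| er_tr u u' : etrel nn G u u' -> etrel nn G (ETr u) (ETr u')
| er_addA u v w : etrel nn G (EAdd u (EAdd v w)) (EAdd (EAdd u v) w)
| er_addC u v : etrel nn G (EAdd u v) (EAdd v u)
| er_add0 u : etrel nn G (EAdd u EZero) u
| er_addN u : etrel nn G (EAdd u (EMul (EConst (-1)) u)) EZero
| er_mulA u v w : etrel nn G (EMul u (EMul v w)) (EMul (EMul u v) w)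
| er_mul1l u : etrel nn G (EMul EOne u) u
| er_mul1r u : etrel nn G (EMul u EOne) u
| er_mulDl u v w : etrel nn G (EMul (EAdd u v) w) (EAdd (EMul u w) (EMul v w))
| er_mulDr u v w : etrel nn G (EMul u (EAdd v w)) (EAdd (EMul u v) (EMul u w))
| er_constD c d : etrel nn G (EAdd (EConst c) (EConst d)) (EConst (c + d))
| er_constM c d : etrel nn G (EMul (EConst c) (EConst d)) (EConst (c * d))
| er_constC c u : etrel nn G (EMul (EConst c) u) (EMul u (EConst c))
| er_idem a b : etrel nn G (EMul (EIdem a) (EIdem b))
                   (if a == b then EIdem a else EZero)
| er_idem_sum : etrel nn G (esum [seq EIdem a | a <- enum 'I_t]) EOne
| er_trD u v : etrel nn G (ETr (EAdd u v)) (EAdd (ETr u) (ETr v))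
| er_trZ c u : etrel nn G (ETr (EMul (EConst c) u)) (EMul (EConst c) (ETr u))
| er_trC u v : etrel nn G (ETr (EMul u v)) (ETr (EMul v u))
| er_trcentral u v : etrel nn G (EMul (ETr u) v) (EMul v (ETr u))
| er_trtr u v : etrel nn G (ETr (EMul (ETr u) v)) (EMul (ETr u) (ETr v))
| er_trE a : etrel nn G (ETr (EIdem a)) (EConst (nn a)%:R)
| er_gen g s : G g -> etrel nn G (esubst s g) EZero.

Definition bsum {t : nat} (nn : 'I_t -> nat) : nat := (\sum_(a < t) nn a)%N.

Definition eidem {F : fieldType} {t : nat} (nn : 'I_t -> nat) (a : 'I_t)
  : 'M[F]_(bsum nn) :=
  \matrix_(i, j) ((i == j) &&
     ((\sum_(b < t | (b < a)%N) nn b)%N <= i)%N &&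
     (i < (\sum_(b < t | (b <= a)%N) nn b)%N)%N)%:R.

Definition eeval {F : fieldType} {t : nat} (nn : 'I_t -> nat)
  (v : nat -> 'M[F]_(bsum nn)) : etm F t -> 'M[F]_(bsum nn) :=
  fix go (u : etm F t) : 'M[F]_(bsum nn) :=
  match u with
  | EVar i => v i
  | EIdem a => eidem nn a
  | EConst c => c%:M
  | EAdd u w => go u + go w
  | EMul u w => go u *m go w
  | ETr u => (\tr (go u))%:M
  end.

Definition is_Etrace_identity {F : fieldType} {t : nat} (nn : 'I_t -> nat)
  (f : etm F t) : Prop :=
  forall v : nat -> 'M[F]_(bsum nn), eeval nn v f = 0.

(* Mixed Cayley-Hamilton polynomial MCH_{k+1}(y_0,...,y_{k-1}), defined   *)
(* by tr(MCH_{k+1}(y_0..y_{k-1}) y_k) = CH_{k+1}(y_0..y_k):               *)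
(* for sigma in S_{k+1}, with s = sigma^-1, the cycle of s through k      *)
(* (k, s k, ..., s^{a-1} k) gives tr(y_{s k} ... y_{s^{a-1} k} y_k), so   *)
(* MCH contributes the word y_{s k} ... y_{s^{a-1} k} times the traces of *)
(* the remaining cycles of s.                                             *)
Definition cyc_word {F : fieldType} {t m : nat} (y : nat -> etm F t)
  (s : {perm 'I_m}) (x : 'I_m) (from : nat) : seq (etm F t) :=
  [seq y (val ((s ^+ j)%g x)) | j <- iota from (#|porbit s x| - from)].

Definition MCH {F : fieldType} {t : nat} (k : nat) (y : nat -> etm F t)
  : etm F t :=
  esum [seq
    (let s : {perm 'I_k.+1} := (sigma^-1)%g in
     EMul (EConst (if odd_perm sigma then -1 else 1))
       (EMul (eprod (cyc_word y s ord_max 1))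
          (eprod [seq ETr (eprod (cyc_word y s (odflt ord_max [pick x in C]) 0))
                 | C : {set 'I_k.+1} <- enum (porbits s) & ord_max \notin C])))
  | sigma : {perm 'I_k.+1} <- enum [set: {perm 'I_k.+1}]].

(* The generators E_a MCH_{n_a+1}(E_a x_0 E_a, ..., E_a x_{n_a-1} E_a) E_a,
   i.e. MCH computed in the corner algebra E_a (.) E_a whose unit is E_a. *)
Definition corner_MCH {F : fieldType} {t : nat} (nn : 'I_t -> nat) (a : 'I_t)
  : etm F t :=
  EMul (EIdem a)
    (EMul (MCH (nn a) (fun i => EMul (EIdem a) (EMul (EVar i) (EIdem a))))
          (EIdem a)).

Definition MCH_gens {F : fieldType} {t : nat} (nn : 'I_t -> nat)
  (g : etm F t) : Prop :=
  exists a : 'I_t, g = corner_MCH nn a.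

(* Main.v *)
(* A multilinear trace monomial in m letters is a permutation of the letters,
   so, after inserting the idempotents, a multilinear identity is a linear
   combination of permutations s which join each letter x_i = E x_i E_b to a
   letter x_(s i) = E_b x_(s i) E.  Suppose s decreases along n_a + 1 positions
   whose letters end in E_a.  Antisymmetrizing over these positions gives a
   multiple of the Cayley-Hamilton polynomial of the corner E_a, and all the
   other terms are lexicographically smaller than s.  Hence modulo the ideal
   every permutation is a combination of those without such long decreasing
   sequences, and the latter are linearly independent as functions of matrices:
   for each of them there is a substitution of matrix units at which it is the
   lexicographically least non-vanishing permutation.  Characteristic zero is
   used only to polarize an arbitrary identity into multilinear ones. *)
Require Import Defs.
From HB Require Import structures.
From mathcomp Require Import all_boot all_order all_algebra all_fingroup.
From mathcomp Require Import boolp.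
Import GRing.Theory.
Local Open Scope ring_scope.
Set Implicit Arguments.
Unset Strict Implicit.

Local Notation orbit := fingraph.orbit.

(** The identity is mixed, while permutations encode pure trace monomials. A matrix [A] is recovered
    from the values tr(A B), but nothing of the kind is known a priori for the formal trace modulo
    the ideal. Hence a marker [z] is adjoined and the closed word [u z v] is given the value [v u],
    so that pure monomials containing [z] once carry the mixed ones. Marked words are multiplied but
    never added; this is why the combinatorics is done in a monoid whose traces alone live in a
    ring, and it then applies to matrices and to the quotient alike. The price is that in the
    quotient the alternating relation of a corner is available only when at most one argument is
    marked: that argument becomes the last entry of CH, the others are substituted in MCH. The
    predicates [Q] and [P] below keep track of this. Since the marker occurs once in each monomial,
    merging letters never creates a second marked one. *)

Record trace_monoid (Z : comPzRingType) := TraceMonoid {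
  tcar :> Type;
  tmul : tcar -> tcar -> tcar;
  tone : tcar;
  ttr : tcar -> Z;
  tmulA : associative tmul;
  tmul1m : left_id tone tmul;
  tmulm1 : right_id tone tmul;
  ttrC : forall x y, ttr (tmul x y) = ttr (tmul y x) }.
Arguments tone {Z t}.

(** * Trace monomials attached to permutations *)

Section TraceMonomials.
Variables (Z : comPzRingType) (M : trace_monoid Z).

Definition tword (L : Type) (x : L -> M) (c : seq L) : M :=
  foldr (fun i a => tmul (x i) a) tone c.

Lemma tword_cat L (x : L -> M) c d :
  tword x (c ++ d) = tmul (tword x c) (tword x d).
Proof. by elim: c => [|i c IH] /=; rewrite ?tmul1m // IH tmulA. Qed.

Lemma ttr_rot L (x : L -> M) n c : ttr (tword x (rot n c)) = ttr (tword x c).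
Proof. by rewrite /rot tword_cat ttrC -tword_cat cat_take_drop. Qed.

Lemma tword_map L L' (f : L' -> L) (x : L -> M) c :
  tword x (map f c) = tword (x \o f) c.
Proof. by elim: c => //= i c ->. Qed.

Lemma eq_in_tword (L : eqType) (x y : L -> M) c :
  {in c, x =1 y} -> tword x c = tword y c.
Proof.
elim: c => //= i c IH e; rewrite e ?mem_head // IH // => j jc.
by rewrite e // inE jc orbT.
Qed.

Variable I : finType.
Implicit Types (A : {set I}) (s : {perm I}) (x y : I -> M) (cs : seq (seq I)).

(** The restriction to cycles inside [A] lets letters be removed one at a time. The starting point
    picked in a cycle is immaterial by cyclicity, and the default 1 is never reached, cycles being
    nonempty. *)
Definition tmono A s x : Z :=
  \prod_(C in porbits s | C \subset A)
    oapp (fun i => ttr (tword x (orbit s i))) 1 [pick i in C].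

(** The cycles of [s] on [A], each written once from some starting point. The empty list is excluded
    because it would contribute tr(1), which no cycle produces. *)
Definition cycle_list A s cs :=
  [/\ uniq (flatten cs), all (fcycle s) cs, [::] \notin cs & A =i flatten cs].

Lemma fconnect_porbit s i j : fconnect s i j = (j \in porbit s i).
Proof.
apply/idP/porbitP => [/iter_findex <-|[n ->]]; last by rewrite permX fconnect_iter.
by exists (findex s i j); rewrite permX.
Qed.

Lemma ttr_orbit s x i j :
  j \in porbit s i -> ttr (tword x (orbit s j)) = ttr (tword x (orbit s i)).
Proof.
rewrite -fconnect_porbit fconnect_orbit => ij.
by rewrite (fingraph.orbitE (cycle_orbit perm_inj i) (orbit_uniq s i) ij) ttr_rot.
Qed.

Lemma ttr_pick s x i :
  oapp (fun i => ttr (tword x (orbit s i))) 1 [pick j in porbit s i] =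
  ttr (tword x (orbit s i)).
Proof.
case: pickP => [j /= ji|/(_ i)]; last by rewrite porbit_id.
exact: ttr_orbit.
Qed.

Lemma porbit_cycle s c i : fcycle s c -> i \in c -> porbit s i =i c.
Proof. by move=> cyc ic j; rewrite -fconnect_porbit (fconnect_cycle cyc). Qed.

Lemma tmono_cycles A s x cs : cycle_list A s cs ->
  tmono A s x = \prod_(c <- cs) ttr (tword x c).
Proof.
elim: cs A => [|c cs IH] A [].
  move=> _ _ _ A0; rewrite big_nil /tmono big1 // => C /andP[/imsetP[i _ ->]].
  by move=> /subsetP/(_ i (porbit_id _ _)); rewrite A0.
rewrite /= cat_uniq => /and3P[Uc dis U] /andP[cyc cycs].
rewrite inE negb_or => /andP[c0 cs0] Ac.
case: c => // i c in c0 Uc dis cyc Ac *.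
have Ci := porbit_cycle cyc (mem_head i c).
rewrite big_cons -(IH (A :\: porbit s i)); last first.
  split=> // j; rewrite inE Ac mem_cat -Ci.
  case: (boolP (j \in porbit s i)) => //= ji; apply/esym.
  by apply: contraNF dis => jcs; apply/hasP; exists j; rewrite //= -Ci.
rewrite /tmono (bigD1 (porbit s i)) /=; last first.
  rewrite imset_f //=; apply/subsetP => j; rewrite Ci Ac mem_cat => ->.
  by [].
rewrite ttr_pick (fingraph.orbitE cyc Uc (mem_head i c)) ttr_rot; congr (_ * _).
apply: eq_bigl => C; rewrite -andbA; apply: andb_id2l => /imsetP[j _ ->].
rewrite subsetD; congr (_ && _); apply/idP/idP => [|dj].
  rewrite eq_porbit_mem => ij; apply/pred0P => k /=; apply: contraNF ij.
  by rewrite -!eq_porbit_mem => /andP[/eqP <-].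
apply: contraTneq dj => ->; apply/pred0Pn; exists i; by rewrite /= porbit_id.
Qed.

Definition stable A s := {in A, forall i, s i \in A}.

Lemma stable_porbit A s i : stable A s -> i \in A -> porbit s i \subset A.
Proof.
move=> st iA; apply/subsetP => j; rewrite -fconnect_porbit => /iter_findex <-.
by elim: (findex _ _ _) => //= n /st.
Qed.

Lemma cycle_list_exists A s : stable A s -> exists cs, cycle_list A s cs.
Proof.
have [n] := ubnP #|A|; elim: n A => // n IH A ltAn st.
have [->|[i iA]] := set_0Vmem A.
  by exists [::]; split=> // i; rewrite inE.
have sub := stable_porbit st iA.
have [|j|cs [U cycs cs0 Acs]] := IH (A :\: porbit s i).
- apply: (@leq_trans #|A|); last by rewrite -ltnS.
  apply: proper_card.
  apply/properP; split; first exact: subsetDl.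
  by exists i; rewrite // inE porbit_id.
- rewrite !inE => /andP[ji jA]; rewrite st // andbT.
  by rewrite -eq_porbit_mem (porbit_perm s 1 j : porbit s (s j) = _) eq_porbit_mem.
have orb : orbit s i =i porbit s i.
  by move=> j; rewrite -fconnect_porbit fconnect_orbit.
exists (orbit s i :: cs); split.
- rewrite /= cat_uniq orbit_uniq U andbT; apply/hasPn => j.
  by rewrite -Acs inE orb => /andP[].
- by rewrite /= cycs (cycle_orbit perm_inj).
- rewrite inE negb_or cs0 andbT; apply: contraTneq (in_orbit s i) => <-.
  by [].
- move=> j; rewrite /= mem_cat orb -Acs inE.
  by case: (boolP (j \in porbit s i)) => //= /(subsetP sub).
Qed.

Lemma cycle_list_head A s i : stable A s -> i \in A ->
  exists cs, cycle_list A s (orbit s i :: cs).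
Proof.
move=> st iA; have [cs [U cycs cs0 Acs]] := cycle_list_exists st.
have /flattenP[c ccs ic] : i \in flatten cs by rewrite -Acs.
have Uc : uniq c.
  elim: (cs) U ccs => //= d cs' IH; rewrite cat_uniq inE.
  by case/and3P=> Ud _ /IH{}IH /orP[/eqP->|/IH].
have cyc := allP cycs _ ccs.
have P : perm_eq (flatten (orbit s i :: rem c cs)) (flatten cs).
  rewrite perm_sym; apply: perm_trans (perm_flatten (perm_to_rem ccs)) _.
  by rewrite /= perm_cat2r (fingraph.orbitE cyc Uc ic) perm_sym perm_rot.
exists (rem c cs); split.
- by rewrite (perm_uniq P).
- rewrite /= (cycle_orbit perm_inj); apply/allP => d /mem_rem dcs.
  exact: (allP cycs).
- rewrite inE negb_or (contra (fun h => mem_rem h) cs0) andbT.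
  by apply: contraTneq (in_orbit s i) => <-.
- by move=> j; rewrite Acs (perm_mem P).
Qed.

Lemma tmono_ext A s x y : {in A, x =1 y} -> tmono A s x = tmono A s y.
Proof.
move=> e; apply: eq_bigr => C /andP[/imsetP[i _ ->] sub].
case: pickP => //= j jC; rewrite (@eq_in_tword _ x y) // => k.
rewrite -fconnect_orbit fconnect_porbit => kj; apply: e.
apply: (subsetP sub).
by move: jC kj; rewrite -!eq_porbit_mem => /eqP<-.
Qed.

Lemma tmono_fix A s x i : stable A s -> i \in A -> s i = i ->
  tmono A s x = ttr (x i) * tmono (A :\ i) s x.
Proof.
move=> st iA si; have [cs cl] := cycle_list_head st iA.
have oi : orbit s i = [:: i].
  have cyc : fcycle s [:: i] by rewrite /= si eqxx.
  by rewrite (fingraph.orbitE cyc) //= ?inE // eqxx rot0.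
rewrite (tmono_cycles x cl) big_cons oi /= tmulm1.
case: cl; rewrite oi /= => /andP[ics U] /andP[_ cycs]; rewrite inE => cs0 Acs.
rewrite (@tmono_cycles _ _ _ cs) //; split=> // j.
by rewrite inE Acs !inE; case: eqP => //= ->; rewrite (negPf ics).
Qed.

(** The product takes the place of the second letter, so that the right end of [x j] stays at
    [j]. *)
Definition tmerge (x : I -> M) (i j : I) : I -> M :=
  fun k => if k == j then tmul (x i) (x j) else x k.

Lemma stable_fix A s i : stable A s -> s i = i -> stable (A :\ i) s.
Proof.
move=> st si j; rewrite !inE => /andP[ji jA]; rewrite st // andbT.
by rewrite -{1}si (inj_eq perm_inj).
Qed.

Lemma stable_contract A s i : stable A s -> i \in A ->
  stable (A :\ i) (s * tperm i (s i))%g.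
Proof.
move=> st iA j; rewrite !inE => /andP[ji jA]; rewrite permM.
case: tpermP => [sj|/perm_inj ij|/eqP sj _]; rewrite ?st ?andbT //.
  by apply: contraNneq ji => e; rewrite -(inj_eq (@perm_inj _ s)) e sj.
by rewrite ij eqxx in ji.
Qed.

(** Bypassing [i] in its cycle: [s * tperm i (s i)] fixes [i] and sends the predecessor of [i] to
    [s i], where the product of the two letters now sits. *)
Lemma tmono_contract A s x i : stable A s -> i \in A -> s i != i ->
  tmono A s x = tmono (A :\ i) (s * tperm i (s i))%g (tmerge x i (s i)).
Proof.
move=> st iA si; have [cs cl] := cycle_list_head st iA.
have [c oi] : exists c, orbit s i = i :: s i :: c.
  have := cycle_orbit (@perm_inj _ s) i; rewrite /orbit -orderSpred /=.
  case: (fingraph.order s i).-1 => [|n] /=; last by exists (traject s (s (s i)) n).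
  by rewrite andbT (negPf si).
rewrite (tmono_cycles x cl) big_cons oi /=.
case: cl; rewrite oi /= => /and3P[]; rewrite inE negb_or => /andP[_ ic] jc U.
case/andP=> /andP[_ cyc] cycs; rewrite inE /= => cs0 Acs.
rewrite (@tmono_cycles _ _ _ ((s i :: c) :: cs)).
  rewrite big_cons /= [tmerge _ _ _ (s i)]/tmerge eqxx tmulA; congr (ttr (tmul _ _) * _).
    apply: eq_in_tword => k kc; rewrite /tmerge; case: eqP => // kj.
    by rewrite -kj mem_cat kc in jc.
  apply: eq_big_seq => d dcs; congr ttr; apply: eq_in_tword => k kd.
  rewrite /tmerge; case: eqP => // kj; rewrite -kj mem_cat in jc.
  by case/norP: jc => _ /flattenP[]; exists d.
split=> /=.
- by rewrite jc.
- apply/andP; split.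
    move: ic jc; rewrite !mem_cat !negb_or => /andP[ic _] /andP[jc _].
    have : forall k, path (frel s) k (rcons c i) ->
        path (frel (s * tperm i (s i))%g) k (rcons c (s i)).
      elim: c ic jc {cyc oi U Acs} => [|l c IH] /= ic jc k.
        by rewrite !andbT => /eqP sk; rewrite permM sk tpermL.
      move: ic jc; rewrite !inE !negb_or => /andP[il ic] /andP[jl jc].
      by case/andP=> /eqP kl p; rewrite permM kl tpermD ?eqxx ?IH.
    exact.

  apply/allP => d dcs; have := allP cycs _ dcs.
  have Hd k : k \in d -> k != i /\ k != s i.
    move=> kd; have kcs : k \in flatten cs by apply/flattenP; exists d.
    move: ic jc; rewrite !mem_cat !negb_or => /andP[_ ics] /andP[_ jcs].
    by split; [apply: contraNneq ics|apply: contraNneq jcs] => <-.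
  have Pd : all [in d] d by apply/allP.
  apply: sub_in_cycle Pd => k k' /Hd[ki kj] /Hd[k'i k'j] /= /eqP sk.
  by rewrite permM sk tpermD // eq_sym.
- by rewrite inE.
- move=> j; rewrite !inE Acs !inE; case: (eqVneq j i) => //= ->.
  by rewrite (negPf ic) eq_sym (negPf si).
Qed.

(** The cycle of [i] is started at [i]. Neither [c] nor [r] depends on the letter at [i]; this
    expresses linearity in one letter without an addition on [M]. *)
Lemma tmono_at A s x i : stable A s -> i \in A ->
  exists (c : Z) (r : M), forall y, {in A, forall k, k != i -> y k = x k} ->
    tmono A s y = ttr (tmul (y i) r) * c.
Proof.
move=> st iA; have [cs cl] := cycle_list_head st iA.
have [c oi] : exists c, orbit s i = i :: c.
  by rewrite /orbit -orderSpred /=; eexists.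
exists (\prod_(d <- cs) ttr (tword x d)), (tword x c) => y yx.
rewrite (tmono_cycles y cl) big_cons oi /=.
case: cl; rewrite oi /= mem_cat negb_or => /andP[/andP[ic ics] _] _ _ Acs.
congr (ttr (tmul _ _) * _).
  apply: eq_in_tword => k kc; apply: yx.
    by rewrite Acs inE mem_cat kc orbT.
  by apply: contraNneq ic => <-.
apply: eq_big_seq => d dcs; congr ttr; apply: eq_in_tword => k kd.
have kcs : k \in flatten cs by apply/flattenP; exists d.
apply: yx; first by rewrite Acs inE mem_cat kcs !orbT.
by apply: contraNneq ics => <-.
Qed.

End TraceMonomials.

Lemma tmono_relabel (Z : comPzRingType) (M : trace_monoid Z) (I J : finType)
    (f : J -> I) (A : {set J}) (s : {perm I}) (s' : {perm J}) (x : I -> M) :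
  injective f -> stable A s' -> {in A, forall j, s (f j) = f (s' j)} ->
  tmono (f @: A) s x = tmono A s' (x \o f).
Proof.
move=> f_inj st sf; have [cs cl] := cycle_list_exists st.
rewrite (tmono_cycles _ cl) (@tmono_cycles _ _ _ _ _ _ (map (map f) cs)).
  by rewrite big_map; apply: eq_bigr => c _; rewrite tword_map.
case: cl => U cycs cs0 Acs; split.
- by rewrite -map_flatten map_inj_uniq.
- apply/allP => _ /mapP[c ccs ->]; rewrite cycle_map.
  have Pc : all [in c] c by apply/allP.
  apply: sub_in_cycle Pc (allP cycs _ ccs) => j k jc kc /= /eqP <-.
  by rewrite sf // Acs; apply/flattenP; exists c.
- apply: contra cs0 => /mapP[c ccs]; by case: c ccs.
- move=> i; rewrite -map_flatten; apply/imsetP/mapP => -[j jA ->]; exists j => //.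
    by rewrite -Acs.
  by rewrite Acs.
Qed.

(** * Antisymmetrization over some of the letters *)

Section Push.
Variables (I J : finType) (f : J -> I).
Implicit Types (s : {perm J}) (i : I) (j : J).

Definition push_fun s i := oapp (fun j => f (s j)) i [pick j | f j == i].

Hypothesis f_inj : injective f.

Lemma push_funE s j : push_fun s (f j) = f (s j).
Proof.
rewrite /push_fun; case: pickP => [k /eqP/f_inj-> //|/(_ j)].
by rewrite eqxx.
Qed.

Lemma push_fun_out s i : i \notin f @: [set: J] -> push_fun s i = i.
Proof.
rewrite /push_fun; case: pickP => //= j /eqP <-.
by rewrite imset_f.
Qed.

Lemma push_fun_inj s : injective (push_fun s).
Proof.
move=> i i'; have [/imsetP[j _ ->]|iN] := boolP (i \in f @: [set: J]);
  have [/imsetP[j' _ ->]|iN'] := boolP (i' \in f @: [set: J]).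
- by rewrite !push_funE => /f_inj/perm_inj->.
- by rewrite push_funE push_fun_out // => e; rewrite -e imset_f in iN'.
- by rewrite push_funE push_fun_out // => e; rewrite e imset_f in iN.
- by rewrite !push_fun_out.
Qed.

Definition push s : {perm I} := perm (@push_fun_inj s).

Lemma pushE s j : push s (f j) = f (s j).
Proof. by rewrite permE push_funE. Qed.

Lemma push_out s i : i \notin f @: [set: J] -> push s i = i.
Proof. by rewrite permE; apply: push_fun_out. Qed.

Lemma push1 : push 1 = 1%g.
Proof.
apply/permP => i; rewrite perm1.
have [/imsetP[j _ ->]|/push_out -> //] := boolP (i \in f @: [set: J]).
by rewrite pushE perm1.
Qed.

End Push.

Section Antisymmetrization.
Variables (Z : comPzRingType) (M : trace_monoid Z) (I J : finType) (f : J -> I).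
Variables (e : M) (Q : M -> Prop) (j0 : J).
Hypothesis f_inj : injective f.
Hypothesis Qmul : forall u v, Q u -> Q v -> Q (tmul u v).
Hypothesis alt0 : forall y : J -> M,
  (forall j, tmul e (y j) = y j) -> (forall j, tmul (y j) e = y j) ->
  (exists k, forall j, j != k -> Q (y j)) ->
  \sum_(s : {perm J}) (-1) ^+ s * tmono [set: J] s y = 0.

Lemma stable_push A s (p : {perm J}) :
  stable A s -> f @: [set: J] \subset A -> stable A (push f_inj p * s)%g.
Proof.
move=> st sub i iA; rewrite permM.
have [/imsetP[j _ ->]|/push_out -> //] := boolP (i \in f @: [set: J]); last exact: st.
by rewrite pushE st // (subsetP sub) // imset_f.
Qed.

(* Every index outside the image of [f] is merged into its successor, which
   does not depend on the permutation being summed over. *)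
Lemma antisymmetrized_tmono A s (x : I -> M) :
  stable A s -> f @: [set: J] \subset A ->
  (forall j, tmul (x (f j)) e = x (f j)) ->
  (forall j, tmul e (x (s (f j))) = x (s (f j))) ->
  (exists k, {in A, forall i, i != k -> Q (x i)}) ->
  \sum_(p : {perm J}) (-1) ^+ p * tmono A (push f_inj p * s)%g x = 0.
Proof.
have [n] := ubnP #|A|; elim: n A s x => // n IH A s x ltAn st sub xe ex [k0 Qx].
have [eqA|[i iAf]] := set_0Vmem (A :\: f @: [set: J]).
  have {eqA sub ltAn}eqA : A = f @: [set: J].
    by apply/eqP; rewrite eqEsubset sub andbT -setD_eq0 eqA.
  have sf j : s (f j) \in f @: [set: J] by rewrite -eqA st // eqA imset_f.
  (* With only the image of [f] left, [s] preserves it and comes from a permutation [s0] of [J]; the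
     sum over the [p * s0] is then [alt0] up to the sign of [s0]. *)
  pose s0f j := odflt j [pick k | f k == s (f j)].
  have s0fE j : f (s0f j) = s (f j).
    rewrite /s0f; case: pickP => [k /eqP //|/= no].
    by have /imsetP[k _ e'] := sf j; have := no k; rewrite e' eqxx.
  have s0_inj : injective s0f.
    by move=> j j' /(congr1 f); rewrite !s0fE => /perm_inj/f_inj.
  pose s0 := perm s0_inj.
  have T p : tmono A (push f_inj p * s)%g x = tmono [set: J] (p * s0)%g (x \o f).
    rewrite eqA; apply: tmono_relabel => // j _; rewrite !permM pushE.
    by rewrite permE s0fE.
  rewrite (eq_bigr (fun p : {perm J} => (-1) ^+ s0 * ((-1) ^+ (p * s0)%g *
      tmono [set: J] (p * s0)%g (x \o f)))); last first.
    by move=> p _; rewrite T mulrA odd_permM -signr_addb addbC addbK.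
  rewrite -mulr_sumr.
  have := reindex_inj (mulIg s0) (P := xpredT) (op := +%R)
    (F := fun p : {perm J} => (-1) ^+ p * tmono [set: J] p (x \o f)).
  rewrite /= => <-; rewrite alt0 ?mulr0 //=.
    move=> j; have /imsetP[k _ sk] := sf (s0^-1 j)%g.
    have := ex (s0^-1 j)%g; rewrite -s0fE.
    by rewrite -(permE s0_inj) permKV.
  have [/imsetP[k _ ek0]|k0N] := boolP (k0 \in f @: [set: J]).
    exists k => j jk; apply: Qx; first by rewrite eqA imset_f.
    by rewrite ek0 (inj_eq f_inj).
  exists j0 => j _; apply: Qx; first by rewrite eqA imset_f.
  by apply: contraNneq k0N => <-; rewrite imset_f.
move: iAf; rewrite inE => /andP[ifN iA].
have iN j : f j != i by apply: contraNneq ifN => <-; rewrite imset_f.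
have subi : f @: [set: J] \subset A :\ i.
  apply/subsetP => _ /imsetP[j _ ->]; rewrite !inE iN (subsetP sub) //.
  by rewrite imset_f.
have ltAi : (#|A :\ i| < n)%N by move: ltAn; rewrite (cardsD1 i A) iA.
have pi p : (push f_inj p * s)%g i = s i by rewrite permM push_out.
have [si|si] := eqVneq (s i) i.
  rewrite (eq_bigr (fun p : {perm J} => ttr (x i) * ((-1) ^+ p *
     tmono (A :\ i) (push f_inj p * s)%g x))); last first.
    move=> p _; rewrite mulrCA -(@tmono_fix _ _ _ A _ x i) // ?pi //.
    exact: stable_push.
  rewrite -mulr_sumr IH ?mulr0 //; first exact: stable_fix.
  by exists k0 => k; rewrite inE => /andP[_ kA]; apply: Qx.
rewrite (eq_bigr (fun p : {perm J} => (-1) ^+ p * tmono (A :\ i)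
    (push f_inj p * (s * tperm i (s i)))%g (tmerge x i (s i)))); last first.
  move=> p _; rewrite (@tmono_contract _ _ _ A _ x i) ?pi ?mulgA //.
  exact: stable_push.
apply: IH => //.
- exact: stable_contract.
- by move=> j; rewrite /tmerge; case: eqP => // <-; rewrite -tmulA xe.
- move=> j; rewrite permM /tmerge; case: tpermP => [sj|/perm_inj ij|].
  + by rewrite eqxx tmulA -sj ex.
  + by have := iN j; rewrite ij eqxx.
  + by move=> _ /eqP/negPf ->; rewrite ex.
(* If the exceptional letter was at [i], it is now part of the merged letter at [s i]. *)
- exists (if k0 == i then s i else k0) => k; rewrite !inE => /andP[ki kA].
  rewrite /tmerge; case: (eqVneq k (s i)) => [->|_] kk0; last first.
    by apply: Qx => //; case: (eqVneq k0 i) kk0 => // ->.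
  case: (eqVneq k0 i) kk0 => [_|ik0 sk0]; first by rewrite eqxx.
  by apply: Qmul; apply: Qx; rewrite // ?st // eq_sym.
Qed.

End Antisymmetrization.

(** * Evaluation of the mixed Cayley-Hamilton polynomial *)

Lemma cyc_wordE (F : fieldType) (t m : nat) (y : nat -> etm F t)
    (s : {perm 'I_m}) (i : 'I_m) k :
  cyc_word y s i k = [seq y (val j) | j <- drop k (orbit s i)].
Proof.
have o : fingraph.order s i = #|porbit s i|.
  by apply: eq_card => j; rewrite -fconnect_porbit.
rewrite /cyc_word /orbit o; move: #|_| => n.
rewrite -[in RHS](subn0 n) -[traject _ _ _]/(traject s (iter 0 s i) _).
have -> : traject s (iter 0 s i) (n - 0) = [seq iter j s i | j <- iota 0 n].
  rewrite subn0; elim: n 0%N => //= n IH j.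
  by rewrite -IH.
rewrite -map_drop drop_iota add0n -map_comp.
by apply: eq_map => j /=; rewrite permX.
Qed.

(** The value of [MCH] in a ring with an operation [tr], to be used for matrices and for the
    quotient ring. *)
Definition ring_mch (R : pzRingType) (tr : R -> R) k (y : nat -> R) : R :=
  \sum_(p : {perm 'I_k.+1}) (-1) ^+ p *
    ((\prod_(j <- behead (orbit p^-1%g ord_max)) y (val j)) *
     \prod_(C <- [seq C : {set 'I_k.+1} <- enum (porbits p^-1%g) | ord_max \notin C])
       tr (\prod_(j <- orbit p^-1%g (odflt ord_max [pick i in C])) y (val j))).

Section EvalMCH.
Variables (F : fieldType) (t : nat) (R : pzRingType) (tr : R -> R).
Variable h : etm F t -> R.
Hypotheses (hD : forall u v, h (EAdd u v) = h u + h v)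
  (hM : forall u v, h (EMul u v) = h u * h v)
  (h0 : h (EConst 0) = 0) (h1 : h (EConst 1) = 1) (hN1 : h (EConst (-1)) = -1)
  (htr : forall u, h (ETr u) = tr (h u)).

Lemma eval_eprod l : h (eprod l) = \prod_(u <- l) h u.
Proof. by elim: l => [|u l IH] /=; rewrite ?big_nil // big_cons -IH. Qed.

Lemma eval_esum l : h (esum l) = \sum_(u <- l) h u.
Proof. by elim: l => [|u l IH] /=; rewrite ?big_nil // big_cons -IH. Qed.

Lemma eval_MCH k y : h (MCH k y) = ring_mch tr k (h \o y).
Proof.
rewrite /MCH eval_esum big_map /ring_mch big_enum /=; apply: eq_big => p.
  by rewrite inE.
rewrite !hM => _; congr (_ * (_ * _)).
- by case: odd_perm; rewrite ?expr1 ?expr0.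
- by rewrite eval_eprod cyc_wordE big_map drop1.
- rewrite eval_eprod big_map; apply: eq_bigr => C _.
  by rewrite htr eval_eprod cyc_wordE big_map drop0.
Qed.

End EvalMCH.

Section TraceMCH.
Variables (R : pzRingType) (tr : R -> R) (Z : comPzRingType).
Variables (M : trace_monoid Z) (inj : R -> M).
Hypotheses (tr_central : forall u v, tr u * v = v * tr u).
Hypotheses (inj1 : inj 1 = tone)
  (injM : forall u v, inj (u * v) = tmul (inj u) (inj v))
  (ttrD : forall r u v, ttr (tmul (inj (u + v)) r) =
     ttr (tmul (inj u) r) + ttr (tmul (inj v) r))
  (ttr_tr : forall r u v, ttr (tmul (inj (tr u * v)) r) =
     ttr (inj u) * ttr (tmul (inj v) r)).

Lemma inj_prod (L : Type) (y : L -> R) c :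
  inj (\prod_(j <- c) y j) = tword (inj \o y) c.
Proof. by elim: c => [|j c IH] /=; rewrite ?big_nil // big_cons injM IH. Qed.

(** The defining relation tr(MCH r) = CH. The cycle through [ord_max] is the word of [MCH] closed up
    by [r]; the traces over the other cycles are central and come out of [ttr]. Since [M] has no
    addition, additivity of [inj] is only asked for under [ttr]. *)
Lemma ttr_mch k (y : nat -> R) (r : M) :
  ttr (tmul (inj (ring_mch tr k y)) r) =
  \sum_(p : {perm 'I_k.+1}) (-1) ^+ p * tmono [set: 'I_k.+1] p^-1%g
     (fun i => if i == ord_max then r else inj (y (val i))).
Proof.
pose g u := ttr (tmul (inj u) r).
have g0 : g 0 = 0 by apply: (addrI (g 0)); rewrite addr0 -{1}ttrD addr0.
have gN u : g (- u) = - g u.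
  by apply: (addrI (g u)); rewrite subrr -ttrD subrr.
rewrite -/(g _) /ring_mch (big_morph g (ttrD r) g0); apply: eq_bigr => p _.
set s := p^-1%g; pose x (i : 'I_k.+1) := if i == ord_max then r else inj (y (val i)).
rewrite -/x.
rewrite -signr_odd; transitivity ((-1) ^+ p *
  g ((\prod_(j <- behead (orbit s ord_max)) y (val j)) *
     \prod_(C <- [seq C : {set 'I_k.+1} <- enum (porbits s) | ord_max \notin C])
       tr (\prod_(j <- orbit s (odflt ord_max [pick i in C])) y (val j)))).
  by rewrite signr_odd; case: (odd_perm p); rewrite ?expr1 ?expr0 ?mulN1r ?gN ?mul1r.
congr (_ * _).
have gtr (T : Type) (l : seq T) (f : T -> R) u :
    g (u * \prod_(C <- l) tr (f C)) = g u * \prod_(C <- l) ttr (inj (f C)).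
  elim: l u => [|C l IH] u; first by rewrite !big_nil !mulr1.
  rewrite !big_cons mulrA -tr_central -mulrA /g ttr_tr -/(g _) IH.
  by rewrite mulrCA.
rewrite gtr /tmono (bigD1 (porbit s ord_max)) /=; last first.
  by rewrite imset_f ?subsetT.
have maxx : x ord_max = r by rewrite /x eqxx.
have xother i : i != ord_max -> x i = inj (y (val i)).
  by rewrite /x => /negPf->.
rewrite ttr_pick; congr (_ * _).
  have [c o] : exists c, orbit s ord_max = ord_max :: c.
    by rewrite /orbit -orderSpred; eexists.
  have := orbit_uniq s ord_max; rewrite o /= maxx ttrC => /andP[maxN _].
  rewrite /g inj_prod; congr (ttr (tmul _ _)); apply: eq_in_tword => i ic /=.
  by rewrite xother //; apply: contraNneq maxN => <-.
rewrite big_filter big_enum_cond /=; apply: eq_big => C.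
  case: imsetP => //= -[i _ ->]; rewrite subsetT /=.
  by rewrite eq_porbit_mem porbit_sym.
case/andP=> /imsetP[i _ ->] maxN.
have {maxN} : forall j, j \in porbit s i -> j != ord_max.
  by move=> j ji; apply: contraNneq maxN => <-.
case: pickP => [j ji|/(_ i)]; last by rewrite porbit_id.
move=> /= nomax.
rewrite inj_prod; congr ttr; apply: eq_in_tword => l.
rewrite -fconnect_orbit fconnect_porbit => lj; rewrite xother // nomax //.
have {}ji : j \in porbit s i := ji.
by rewrite -eq_porbit_mem in ji; rewrite -(eqP ji).
Qed.

End TraceMCH.

(** * Straightening of permutations, and independence of the good ones *)

Section Straightening.
Variables (N t : nat) (nn : 'I_t -> nat) (al be : 'I_N -> 'I_t).
Implicit Types (s u : {perm 'I_N}) (i j : 'I_N).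

Definition lexlt s u :=
  [exists i, (s i < u i)%N && [forall j : 'I_N, (j < i)%N ==> (s j == u j)]].

Lemma lexltP s u :
  reflect (exists2 i, (s i < u i)%N & forall j, (j < i)%N -> s j = u j) (lexlt s u).
Proof.
apply: (iffP existsP) => [[i /andP[lti /forallP eqj]]|[i lti eqj]]; exists i => //.
  by move=> j ji; apply/eqP; apply: (implyP (eqj j)).
by rewrite lti; apply/forallP => j; apply/implyP => /eqj->.
Qed.

Lemma lexlt_irr s : lexlt s s = false.
Proof. by apply/lexltP => -[i]; rewrite ltnn. Qed.

Lemma lexlt_trans : transitive lexlt.
Proof.
move=> u s v /lexltP[i lti ei] /lexltP[j ltj ej]; apply/lexltP.
case: (ltngtP i j) => [ij|ji|/val_inj eij].
- exists i; first by rewrite -ej.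
  by move=> k ki; rewrite ei // ej // (ltn_trans ki).
- exists j; first by rewrite ei.
  by move=> k kj; rewrite ei ?ej // (ltn_trans kj).
- rewrite -eij in ltj ej; exists i; first exact: ltn_trans ltj.
  by move=> k ki; rewrite ei // ej.
Qed.

Lemma first_diff s u : s != u ->
  exists2 i, s i != u i & forall j, (j < i)%N -> s j = u j.
Proof.
move=> su; have [i0 i0P] : exists i, s i != u i.
  apply/existsP; apply: contraNT su => /existsPn eqsu.
  by apply/eqP/permP => i; apply/eqP; rewrite -[_ == _]negbK eqsu.
case: (@arg_minnP _ i0 (fun i => s i != u i) val i0P) => i iP imin; exists i => // j ji.
by apply/eqP; apply: contraTT ji => /imin; rewrite -leqNgt.
Qed.

Definition compat s := [forall i, be i == al (s i)].

Definition descent s a (f : 'I_(nn a).+1 -> 'I_N) :=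
  [/\ injective f, forall k, be (f k) = a &
      forall k k', (f k < f k')%N -> (s (f k') < s (f k))%N].
Arguments descent : clear implicits.

Definition good s := compat s /\ forall a f, ~ descent s a f.

(** The first moved position [f k] goes to [f (p k)], which lies further to the right because
    everything before is fixed; as [s] decreases along [f], the value there drops. *)
Lemma push_lexlt s a f (f_inj : injective f) p :
  descent s a f -> p != 1%g -> lexlt (push f_inj p * s) s.
Proof.
move=> [_ _ dec] p1; have : push f_inj p != 1%g.
  apply: contraNneq p1 => e; apply/eqP/permP => k; apply: (f_inj _ _).
  by rewrite -(pushE f_inj) e !perm1.
case/first_diff=> i; rewrite perm1 => pi imin.
have imin' j : (j < i)%N -> push f_inj p j = j by move/imin; rewrite perm1.
apply/lexltP; exists i; last by move=> j ji; rewrite permM imin'.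
have /imsetP[k _ ik] : i \in f @: [set: 'I_(nn a).+1].
  by apply: contraR pi => /push_out->.
rewrite permM ik pushE; apply: dec; rewrite -ik ltnNge leq_eqVlt.
apply/negP => /orP[/eqP/val_inj e|].
  by move: pi; rewrite [in push _ _ _]ik pushE e eqxx.
move=> /[dup]/imin' + lti; rewrite pushE => /f_inj/perm_inj e.
by move: pi; rewrite [in push _ _ _]ik pushE e -ik eqxx.
Qed.

(* The coefficients [b] do not depend on the function [L]: they are used
   simultaneously for matrices and for the free algebra. *)
Lemma straighten s : exists b : {perm 'I_N} -> int,
  (forall u, b u != 0 -> good u) /\
  forall (V : zmodType) (L : {perm 'I_N} -> V),
    (forall u, ~~ compat u -> L u = 0) ->
    (forall u a (f : 'I_(nn a).+1 -> 'I_N) (f_inj : injective f),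
       (forall k, be (f k) = a) -> compat u ->
       \sum_(p : {perm 'I_(nn a).+1}) L (push f_inj p * u)%g *~ (-1) ^+ p = 0) ->
    L s = \sum_u L u *~ b u.
Proof.
have [n] := ubnP #|[set u | lexlt u s]|; elim: n s => // n IH s lt_n.
have [cs|ncs] := boolP (compat s); last first.
  exists (fun=> 0); split=> [u|V L L0 _]; first by rewrite eqxx.
  by rewrite L0 // big1.
have [[a [f df]]|nobad] := EM (exists a f, descent s a f); last first.
  exists (fun u => (u == s)%:R); split=> [u|V L _ _].
    case: (eqVneq u s) => [-> _|_]; last by rewrite eqxx.
    by split=> // a f df; apply: nobad; exists a, f.
  by rewrite (bigD1 s) //= eqxx big1 ?addr0 // => u /negPf->.
have [f_inj ft dec] := df.
have /fin_all_exists[b bP] p : exists b : {perm 'I_N} -> int, p != 1%g ->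
    (forall u, b u != 0 -> good u) /\
    forall (V : zmodType) (L : {perm 'I_N} -> V),
    (forall u, ~~ compat u -> L u = 0) ->
    (forall u a (f : 'I_(nn a).+1 -> 'I_N) (f_inj : injective f),
       (forall k, be (f k) = a) -> compat u ->
       \sum_(p : {perm 'I_(nn a).+1}) L (push f_inj p * u)%g *~ (-1) ^+ p = 0) ->
    L (push f_inj p * s)%g = \sum_u L u *~ b u.
  have [->|p1] := eqVneq p 1%g; first by exists (fun=> 0).
  have lts := push_lexlt f_inj df p1.
  have [|b bP] := IH (push f_inj p * s)%g; last by exists b.
  apply: (@leq_trans #|[set u | lexlt u s]|); last by rewrite -ltnS.
  apply: proper_card; apply/properP; split.
    by apply/subsetP => u; rewrite !inE => /lexlt_trans; apply.
  by exists (push f_inj p * s)%g; rewrite inE ?lexlt_irr.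
(* The alternating relation is solved for its term at [p = 1], which is [L s]. *)
exists (fun u => - \sum_(p | p != 1%g) b p u * (-1) ^+ p); split=> [u|V L L0 Lalt].
  rewrite oppr_eq0 => nz; have [p p1 bpu] : exists2 p, p != 1%g & b p u != 0.
    apply/exists_inP; apply: contraNT nz => /exists_inPn b0.
    rewrite big1 // => p p1; have := b0 p p1; rewrite negbK => /eqP->.
    by rewrite mul0r.
  by have [+ _] := bP p p1; apply.
have := Lalt s a f f_inj ft cs; rewrite (bigD1 1%g) //= push1 mul1g odd_perm1 mulr1z.
move/eqP; rewrite addr_eq0 => /eqP ->.
under [RHS]eq_bigr do rewrite mulrNz mulrz_sumr.
rewrite sumrN exchange_big /=; congr (- _); apply: eq_bigr => p p1.
have [_ ->] := bP p p1; rewrite // mulrz_suml; apply: eq_bigr => u _.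
by rewrite mulrzA.
Qed.

Definition decreasing s (A : {set 'I_N}) :=
  [forall i in A, forall j in A, (i < j)%N ==> (s j < s i)%N].

Definition chain s i (A : {set 'I_N}) :=
  [&& i \in A, [forall j in A, (j <= i)%N && (be j == be i)] & decreasing s A].

(** The labelling of the Erdos-Szekeres argument, within one type: [s] does not invert two positions
    of equal type and equal depth. *)
Definition depth s i := (\max_(A : {set 'I_N} | chain s i A) #|A|)%N.

Lemma decreasingP s (A : {set 'I_N}) :
  reflect {in A &, forall i j, (i < j)%N -> (s j < s i)%N} (decreasing s A).
Proof.
apply: (iffP forall_inP) => [dec i j iA jA ij|dec i iA].
  by have /forall_inP/(_ j jA)/implyP := dec i iA; apply.
by apply/forall_inP => j jA; apply/implyP; apply: dec.
Qed.

Lemma chain1 s i : chain s i [set i].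
Proof.
rewrite /chain inE eqxx /=; apply/andP; split.
  by apply/forall_inP => j; rewrite inE => /eqP->; rewrite leqnn eqxx.
by apply/decreasingP => j k; rewrite !inE => /eqP-> /eqP->; rewrite ltnn.
Qed.

Lemma depth_gt0 s i : (0 < depth s i)%N.
Proof.
have := @leq_bigmax_cond _ (chain s i) (fun A => #|A|) _ (chain1 s i).
by rewrite cards1.
Qed.

Lemma depth_chain s i : exists2 A, chain s i A & #|A| = depth s i.
Proof.
have [|A cA dA] := @eq_bigmax_cond _ [pred A | chain s i A] (fun A => #|A|).
  by apply/card_gt0P; exists [set i]; rewrite inE chain1.
by exists A; rewrite // -dA.
Qed.

(** A longest chain at [i] is extended by [j], because [s i] is the least value of [s] on it. *)
Lemma depth_lt s i j : (i < j)%N -> be i = be j -> (s j < s i)%N ->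
  (depth s i < depth s j)%N.
Proof.
move=> ij bij sji; have [A /and3P[iA /forall_inP Ai /decreasingP dec] <-] := depth_chain s i.
have jA : j \notin A by apply: contraTN ij => /Ai/andP[+ _]; rewrite -leqNgt.
have cA : chain s j (j |: A).
  rewrite /chain setU11 /=; apply/andP; split.
    apply/forall_inP => k /setU1P[->|/Ai/andP[ki /eqP->]]; rewrite ?leqnn ?eqxx //.
    by rewrite bij eqxx (leq_trans ki) // ltnW.
  have sjk k : k \in A -> (s j < s k)%N.
    move=> kA; have /andP[ki _] := Ai _ kA; apply: leq_trans sji _.
    by move: ki; rewrite leq_eqVlt => /orP[/eqP/val_inj->//|/(dec _ _ kA iA)/ltnW].
  apply/decreasingP => k l /setU1P[->|kA] /setU1P[->|lA].
  - by rewrite ltnn.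
  - have /andP[li _] := Ai _ lA; move=> jl.
    by have := leq_ltn_trans li (ltn_trans ij jl); rewrite ltnn.
  - by move=> _; apply: sjk.
  - exact: dec.
have := @leq_bigmax_cond _ (chain s j) (fun B => #|B|) _ cA.
by rewrite cardsU1 jA.
Qed.

(** In a longer chain, any [(nn (be i)).+1] elements form a descent. *)
Lemma depth_good s i : good s -> (depth s i <= nn (be i))%N.
Proof.
move=> [_ nod]; rewrite leqNgt; apply/negP => lt_d.
have [A /and3P[iA /forall_inP Ai /decreasingP dec] cA] := depth_chain s i.
rewrite -cA in lt_d; apply: (nod (be i) (fun k => enum_val (widen_ord lt_d k))).
split=> [k k' /enum_val_inj/(congr1 val)/= /val_inj //|k|k k'].
  by have /andP[_ /eqP] := Ai _ (enum_valP (widen_ord lt_d k)).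
by apply: dec; apply: enum_valP.
Qed.

(* Colouring the position [i] by its type and by the length of the longest
   decreasing sequence ending there makes [s] the lexicographically least of
   the permutations which transport [c] to [c \o s^-1]. *)
Lemma good_independent (R : pzRingType) (b : {perm 'I_N} -> R) :
  (forall u, b u != 0 -> good u) ->
  (forall c d : 'I_N -> 'I_t * nat,
     (forall i, (c i).1 = be i /\ ((c i).2 < nn (be i))%N) ->
     (forall i, (d i).1 = al i /\ ((d i).2 < nn (al i))%N) ->
     \sum_u b u * [forall i, c i == d (u i)]%:R = 0) ->
  forall s, b s = 0.
Proof.
move=> bgood b0 s; have [n] := ubnP #|[set u | lexlt s u]|.
elim: n s => // n IH s lt_n; apply/eqP/negPn/negP => nz.
have gs := bgood _ nz; have [/forallP cs _] := gs.
(* Depths run from 1 to [nn (be i)]; the predecessor brings them below [nn (be i)]. *)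
pose c i := (be i, (depth s i).-1); pose d i := c (s^-1 i)%g.
have cP i : (c i).1 = be i /\ ((c i).2 < nn (be i))%N.
  by split=> //=; have := depth_good i gs; have := depth_gt0 s i; case: depth.
have := b0 c d cP; rewrite (bigD1 s) //= big1 ?addr0 => [e|u us].
  have := e _; rewrite (_ : [forall i, _] = true) ?mulr1.
    move=> e'; rewrite e' ?eqxx // in nz => i; rewrite /d.
    by have := eqP (cs (s^-1 i)%g); rewrite permKV => <-; apply: cP.
  by apply/forallP => i; rewrite /d permK.
case: forallP => [cd|_]; rewrite ?mulr0 ?mulr1 //.
have [i si imin] : exists2 i, s i != u i & forall j, (j < i)%N -> s j = u j.
  by apply: first_diff; rewrite eq_sym.
suff lt_su : lexlt s u.
  rewrite IH //; apply: (@leq_trans #|[set u | lexlt s u]|); last by rewrite -ltnS.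
  apply: proper_card; apply/properP; split.
    by apply/subsetP => v; rewrite !inE => /(lexlt_trans lt_su).
  by exists u; rewrite inE ?lexlt_irr.
apply/lexltP; exists i => //; rewrite ltnNge leq_eqVlt; apply/negP => /orP[/eqP/val_inj e|].
  by rewrite e eqxx in si.
(* If [u i < s i], then [j] has the colour of [i] and [s j < s i]. Here [i < j] contradicts
   [depth_lt], and [j < i] contradicts the injectivity of [u], which agrees with [s] before [i]. *)
pose j := (s^-1 (u i))%g; have sj : s j = u i by rewrite permKV.
rewrite -sj => lt_s; have /eqP := cd i; rewrite /d -/j => -[bij dij].
case: (ltngtP i j) => [ij|ji|/val_inj eij].
- have := depth_lt ij bij lt_s.
  by move: dij; case: depth (depth_gt0 s i) => // ? _; case: depth (depth_gt0 s j) => // ? _ /= ->; rewrite ltnn.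
- by have := imin j ji; rewrite sj => /perm_inj eij; rewrite eij ltnn in ji.
- by rewrite -eij ltnn in lt_s.
Qed.

End Straightening.

(** * Trace monomials of matrices, expanded in matrix units *)

Definition update (I : eqType) (V : Type) (x : I -> V) i v : I -> V :=
  fun j => if j == i then v else x j.

(** [V] carries no addition: that [S i] is the sum of the [b i c] is expressed only through [Phi],
    one coordinate at a time, the others being arbitrary. *)
Lemma multiadditive_expand (I K : finType) (V : Type) (W : nmodType)
    (Phi : (I -> V) -> W) (b : I -> K -> V) (S : I -> V) :
  (forall i x, Phi (update x i (S i)) = \sum_c Phi (update x i (b i c))) ->
  Phi S = \sum_(h : {ffun I -> K}) Phi (fun i => b i (h i)).
Proof.
move=> add; case: (pickP (@predT K)) => [c0 _|K0]; last first.
  case: (pickP (@predT I)) => [i _|I0].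
    rewrite [RHS]big_pred0 => [|h]; last by have := K0 (h i).
    have -> : S = update S i (S i).
      by apply/funext => j; rewrite /update; case: eqP => [->|].
    by rewrite add big_pred0.
  have IE (x y : I -> V) : x = y by apply/funext => i; have := I0 i.
  have h0 : {ffun I -> K} by apply/finfun => i; have := I0 i.
  rewrite (big_pred1 h0) => [|h]; first by congr Phi; apply: IE.
  by apply/esym/eqP/ffunP => i; have := I0 i.
(* Only the coordinates in [r] are expanded. Choice functions are pinned to [c0] elsewhere, so that
   each choice on [r] is counted once. *)
have split_sum r : uniq r -> forall x,
    Phi (fun i => if i \in r then S i else x i) =
    \sum_(h in pfamily c0 (mem r) (fun=> predT))
      Phi (fun i => if i \in r then b i (h i) else x i).
  elim: r => [|i r IH] /= => [_ x|/andP[ir Ur] x].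
    rewrite (big_pred1 [ffun=> c0]) // => h.
    apply/familyP/eqP => /= [H|-> j]; last by rewrite ffunE inE.
    by apply/ffunP => j; have := H j; rewrite ffunE => /eqP.
  have {}IH := IH Ur; pose y j := if j \in r then S j else x j.
  have -> : (fun j => if j \in i :: r then S j else x j) = update y i (S i).
    apply/funext => j; rewrite /update inE.
    by case: (eqVneq j i) => [->|].
  rewrite add (partition_big (fun h : {ffun I -> K} => h i) predT) //=.
  pose seti c (h : {ffun I -> K}) := [ffun k => if k == i then c else h k].
  apply: eq_bigr => c _.
  have -> : update y i (b i c) =
      (fun j => if j \in r then S j else update x i (b i c) j).
    apply/funext => j; rewrite /update /y; case: (eqVneq j i) => [->|//].
    by rewrite (negPf ir).
  rewrite IH [RHS](reindex_onto (seti c) (seti c0)) /=; last first.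
    move=> h /andP[_ /eqP hi]; apply/ffunP => k; rewrite !ffunE.
    by case: eqP => // ->.
  apply: eq_big => [h|h _]; last first.
    congr Phi; apply/funext => j; rewrite /update inE ffunE.
    by case: (eqVneq j i) => [->|//]; rewrite (negPf ir).
  rewrite !ffunE !eqxx andbT; apply/familyP/andP => /= [H|[/familyP H /eqP hE] k].
    split; last first.
      apply/eqP/ffunP => k; rewrite !ffunE; case: eqP => // ->.
      by have := H i; rewrite /= (negPf ir) => /eqP.
    apply/familyP => k; have := H k; rewrite /= inE !ffunE.
    by case: eqP => //= ->; rewrite inE.
  have := H k; rewrite /= inE !ffunE; case: (eqVneq k i) => //= -> _.
  by rewrite (negPf ir) -hE !ffunE eqxx !inE.
have := split_sum (enum I) (enum_uniq I) S.
have -> : (fun i => if i \in enum I then S i else S i) = S.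
  by apply/funext => i; rewrite if_same.
move=> ->; apply: eq_big => h.
  by apply/familyP => k; rewrite /= mem_enum !inE.
by move=> _; congr Phi; apply/funext => i; rewrite mem_enum.
Qed.

Section MatrixMonomials.
Variables (F : fieldType) (n : nat).

Definition mx_trace_monoid : trace_monoid F :=
  @TraceMonoid F 'M[F]_n mulmx 1%:M (fun A => \tr A)
    (@mulmxA _ _ _ _ _) (@mul1mx _ _ _) (@mulmx1 _ _ _) (@mxtrace_mulC _ _ _).

Variable I : finType.
Implicit Types (s : {perm I}).
Local Notation mxmono s x := (@tmono F mx_trace_monoid I [set: I] s x).

Lemma stableT s : stable [set: I] s.
Proof. by move=> i; rewrite !inE. Qed.

Lemma big_cycle_list s cs (f : I -> F) : cycle_list [set: I] s cs ->
  \prod_(c <- cs) \prod_(i <- c) f i = \prod_i f i.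
Proof.
case=> U _ _ Acs; rewrite -big_flatten; apply: perm_big.
apply: uniq_perm => //; first exact: index_enum_uniq.
by move=> i; rewrite -Acs inE mem_index_enum.
Qed.

Lemma mxmono_sum (K : finType) s (b : I -> K -> 'M[F]_n) :
  mxmono s (fun i => \sum_c b i c) =
  \sum_(h : {ffun I -> K}) mxmono s (fun i => b i (h i)).
Proof.
apply: (multiadditive_expand (Phi := fun x => mxmono s x)) => i x.
have [c [r mono]] := tmono_at x (stableT s) (in_setT i).
have E z : mxmono s (update x i z) = \tr (z *m r) * c.
  rewrite mono /=; first by rewrite /update eqxx.
  by move=> k _; rewrite /update => /negPf->.
rewrite E mulmx_suml raddf_sum mulr_suml; apply: eq_bigr => k _.
by rewrite E.
Qed.

Lemma mxmono_scale s (w : I -> F) (x : I -> 'M[F]_n) :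
  mxmono s (fun i => w i *: x i) = (\prod_i w i) * mxmono s x.
Proof.
have [cs cl] := cycle_list_exists (stableT s).
rewrite !(tmono_cycles _ cl) -(big_cycle_list w cl) -big_split /=.
apply: eq_bigr => c _; rewrite -mxtraceZ; congr (\tr _).
elim: c => [|i c IH] /=; first by rewrite big_nil scale1r.
by rewrite big_cons IH -scalemxAl -scalemxAr scalerA.
Qed.

(** Consecutive matrix units multiply to zero unless the column of one is the row of the next; the
    trace contributes the condition that closes the cycle. *)
Lemma mxmono_delta s (u v : I -> 'I_n) :
  mxmono s (fun i => delta_mx (u i) (v i)) = \prod_i (v i == u (s i))%:R.
Proof.
have [cs cl] := cycle_list_exists (stableT s).
rewrite (tmono_cycles _ cl) -(big_cycle_list _ cl); case: cl => _ cycs cs0 _.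
apply: eq_big_seq => c ccs; have := allP cycs _ ccs.
case: c ccs => [/(negP cs0) //|i c _] /=; rewrite rcons_path => /andP[ic /eqP lasti].
have -> : mulmx (delta_mx (u i) (v i))
    (tword (M := mx_trace_monoid) (fun i => delta_mx (u i) (v i)) c) =
    (\prod_(j <- belast i c) (v j == u (s j))%:R) *: delta_mx (u i) (v (last i c)).
  elim: c i ic {lasti} => [|j c IH] i /=.
    by move=> _; rewrite big_nil scale1r mulmx1.
  case/andP=> /eqP sij jc; rewrite IH // -scalemxAr mul_delta_mx_cond big_cons.
  by rewrite sij -scaler_nat scalerA mulrC.
rewrite mxtraceZ lastI big_rcons /= lasti; congr (_ * _).
rewrite /mxtrace (bigD1 (u i)) //= mxE eqxx /= big1 ?addr0.
  by rewrite eq_sym.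
by move=> j /negPf ji; rewrite mxE ji.
Qed.

End MatrixMonomials.

(** * The diagonal idempotents as blocks of indices *)

Section Blocks.
Variables (F : fieldType) (t : nat) (nn : 'I_t -> nat).
Local Notation n := (bsum nn).
Local Notation e := (@eidem F t nn).

Definition offset k := (\sum_(b < t | (b < k)%N) nn b)%N.

Definition in_block (a : 'I_t) i := (offset a <= i < offset a.+1)%N.

Lemma offsetS (a : 'I_t) : offset a.+1 = (offset a + nn a)%N.
Proof.
rewrite /offset (bigD1 a) //= addnC; congr addn; apply: eq_bigl => b.
by rewrite ltnS [in RHS]ltn_neqAle andbC.
Qed.

Lemma offset_le k l : (k <= l)%N -> (offset k <= offset l)%N.
Proof.
move=> kl; rewrite /offset big_mkcond [leqRHS]big_mkcond /=.
apply: leq_sum => b _; case: ifP => // bk.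
by rewrite (leq_trans bk kl).
Qed.

Lemma offset_last : offset t = n.
Proof. by apply: eq_bigl => b; rewrite ltn_ord. Qed.

Lemma in_block_uniq a b i : in_block a i -> in_block b i -> a = b.
Proof.
move=> /andP[ai ia] /andP[bi ib]; apply/val_inj; case: (ltngtP a b) => // ab.
  by have := leq_ltn_trans (leq_trans (offset_le ab) bi) ia; rewrite ltnn.
by have := leq_ltn_trans (leq_trans (offset_le ab) ai) ib; rewrite ltnn.
Qed.

Lemma in_block_exists i : (i < n)%N -> exists a, in_block a i.
Proof.
rewrite -offset_last => lt_i; have ex : exists k, (i < offset k)%N by exists t.
case: (ex_minnP ex) => -[|k]; first by rewrite /offset big_pred0.
move=> ik kmin; have kt : (k < t)%N by apply: kmin.
exists (Ordinal kt); rewrite /in_block /= ik andbT leqNgt.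
by apply/negP => /kmin; rewrite ltnn.
Qed.

Lemma eidemE a i j : e a i j = ((i == j) && in_block a i)%:R.
Proof. by rewrite mxE -andbA. Qed.

Lemma eidem_mul_left a m (A : 'M_(n, m)) i j :
  (e a *m A) i j = (in_block a i)%:R * A i j.
Proof.
rewrite mxE (bigD1 i) //= eidemE eqxx /= big1 ?addr0 // => k ki.
by rewrite eidemE eq_sym (negPf ki) mul0r.
Qed.

Lemma eidem_mul_right a m (A : 'M_(m, n)) i j :
  (A *m e a) i j = A i j * (in_block a j)%:R.
Proof.
rewrite mxE (bigD1 j) //= eidemE eqxx /= big1 ?addr0 // => k /negPf kj.
by rewrite eidemE kj mulr0.
Qed.

Lemma eidemM a b : e a *m e b = if a == b then e a else 0.
Proof.
apply/matrixP => i j; rewrite eidem_mul_left eidemE.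
case: (eqVneq a b) => [<-|ab]; first by rewrite eidemE -natrM mulnb andbCA andbb.
rewrite mxE; case: (boolP (in_block b i)) => [bi|]; last first.
  by rewrite andbF mulr0.
case: (boolP (in_block a i)) => [ai|]; last by rewrite mul0r.
by rewrite (in_block_uniq ai bi) eqxx in ab.
Qed.

Lemma eidem_sum : \sum_a e a = 1%:M.
Proof.
apply/matrixP => i j; rewrite summxE mxE.
have [a ai] := in_block_exists (ltn_ord i).
rewrite (bigD1 a) //= eidemE ai andbT big1 ?addr0 // => b ba.
rewrite eidemE; case: (boolP (in_block b i)) => [bi|]; last by rewrite andbF.
by rewrite (in_block_uniq bi ai) eqxx in ba.
Qed.

Lemma sum_in_block a : (\sum_(i < n) in_block a i)%N = nn a.
Proof.
have sub : (offset a.+1 <= n)%N by rewrite -offset_last offset_le.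
rewrite (eq_bigr (fun i : 'I_n => if in_block a i then 1 else 0)%N); last first.
  by move=> i _; case: in_block.
rewrite -big_mkcond -(big_mkord (fun i => in_block a i) (fun=> 1%N)) /=.
transitivity (\sum_(offset a <= i < offset a.+1) 1)%N; last first.
  by rewrite sum_nat_const_nat muln1 offsetS addKn.
rewrite [RHS](big_nat_widen _ _ n) // [RHS](big_nat_widenl _ 0%N) //.
by apply: eq_bigl => i; rewrite andbC.
Qed.

Lemma mxtrace_eidem a : \tr (e a) = (nn a)%:R.
Proof.
rewrite -sum_in_block natr_sum; apply: eq_bigr => i _.
by rewrite eidemE eqxx.
Qed.

Local Notation mxmono s x := (tmono (M := mx_trace_monoid F n) setT s x).

Lemma corner_entry a (A : 'M_n) i j : e a *m A = A -> A *m e a = A ->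
  A i j = (in_block a i && in_block a j)%:R * A i j.
Proof.
move=> eA Ae; rewrite -{1}Ae eidem_mul_right -{1}eA eidem_mul_left.
by rewrite mulrC mulrA -natrM mulnb andbC.
Qed.

(* Expanding in matrix units turns the sum into determinants with two equal
   rows, since the [nn a + 1] column indices lie in a block of size [nn a]. *)
Lemma mx_alt0 a (y : 'I_(nn a).+1 -> 'M[F]_n) :
  (forall j, e a *m y j = y j) -> (forall j, y j *m e a = y j) ->
  \sum_(p : {perm 'I_(nn a).+1}) (-1) ^+ p * mxmono p y = 0.
Proof.
move=> ey ye.
have yE : y = fun i => \sum_(c : 'I_n * 'I_n) y i c.1 c.2 *: delta_mx c.1 c.2.
  apply/funext => i; rewrite {1}(matrix_sum_delta (y i)).
  by rewrite pair_big.
rewrite yE; under eq_bigr do rewrite mxmono_sum mulr_sumr.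
rewrite exchange_big big1 //= => h _.
under eq_bigr do rewrite mxmono_scale mulrCA mxmono_delta.
rewrite -mulr_sumr.
have [/existsP[j outj]|] := boolP [exists j, ~~ in_block a (h j).2].
  rewrite (bigD1 j) //= (corner_entry _ _ (ey j) (ye j)) (negPf outj).
  by rewrite andbF !mul0r.
move/existsPn => inh.
have {}inh j : in_block a (h j).2 by rewrite -[in_block _ _]negbK inh.
pose A : 'M[F]_((nn a).+1) := \matrix_(i, j) ((h i).2 == (h j).1)%:R.
have -> : \sum_(p : {perm 'I_(nn a).+1}) (-1) ^+ p *
    \prod_i ((h i).2 == (h (p i)).1)%:R = \det A.
  by apply: eq_bigr => p _; congr (_ * _); apply: eq_bigr => i _; rewrite mxE.
have pos j : ((h j).2 - offset a < nn a)%N.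
  by have /andP[le lt] := inh j; rewrite ltn_subLR // -offsetS.
have [j [k [jk ejk]]] : exists j k, j != k /\ (h j).2 = (h k).2.
  have /injectivePn[j [k jk ejk]] : ~~ injectiveb (fun j => Ordinal (pos j)).
    by apply/injectiveP => /leq_card; rewrite !card_ord ltnn.
  exists j, k; split=> //; apply/val_inj; move/(congr1 val): ejk => /=.
  have /andP[lej _] := inh j; have /andP[lek _] := inh k.
  by move/(congr1 (addn (offset a))); rewrite !subnKC.
rewrite (determinant_alternate jk) ?mulr0 // => i.
by rewrite !mxE ejk.
Qed.

End Blocks.

(** [MCH] reads its cycles off the inverse permutation, [tmono] off the permutation itself; in a
    signed sum over all permutations this makes no difference. *)
Lemma sum_perm_inv (Z : pzRingType) (I : finType) (T : {perm I} -> Z) :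
  \sum_(p : {perm I}) (-1) ^+ p * T p^-1%g = \sum_(p : {perm I}) (-1) ^+ p * T p.
Proof.
rewrite [RHS](reindex_inj invg_inj) /=.
by apply: eq_bigr => p _; rewrite odd_permV.
Qed.

Lemma mxtrace_nondegenerate (F : fieldType) n (A : 'M[F]_n) :
  (forall B, \tr (A *m B) = 0) -> A = 0.
Proof.
move=> A0; apply/matrixP => i j; rewrite mxE -(A0 (delta_mx j i)).
rewrite /mxtrace (bigD1 i) //= mxE (bigD1 j) //= mxE !eqxx mulr1.
rewrite !big1 ?addr0 // => [k ki|k kj].
  by rewrite mxE big1 // => l _; rewrite mxE (negPf ki) andbF mulr0.
by rewrite mxE (negPf kj) mulr0.
Qed.

(** * Elements of the ideal are identities *)

Section Soundness.
Variables (F : fieldType) (t : nat) (nn : 'I_t -> nat).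
Local Notation n := (bsum nn).
Local Notation e := (@eidem F t nn).

(** Paired with any [B] under the trace, the generator becomes CH with last argument [e a B e a].
    All [nn a + 1] arguments then lie in the corner, where [mx_alt0] applies. *)
Lemma eeval_generator v (s : nat -> etm F t) a :
  eeval nn v (esubst s (corner_MCH nn a)) = 0.
Proof.
pose h u := eeval nn v (esubst s u).
pose tr (A : 'M[F]_n) : 'M[F]_n := (\tr A)%:M.
pose y i : etm F t := EMul (EIdem a) (EMul (EVar i) (EIdem a)).
rewrite -[LHS]/(e a *m (h (MCH (nn a) y) *m e a)).
have h0 : h (EConst 0) = 0 by rewrite /h /= raddf0.
have hN1 : h (EConst (-1)) = -1 by rewrite /h /= raddfN.
rewrite (eval_MCH (h := h) (tr := tr)) //.
apply: mxtrace_nondegenerate => B.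
rewrite -!mulmxA mxtrace_mulC -!mulmxA.
apply: (etrans (@ttr_mch _ tr _ (mx_trace_monoid F n) id _ _ _ _ _ (nn a)
  (h \o y) (e a *m (B *m e a)))).
- by move=> A C; rewrite /tr -![_ * _]/(_ *m _) scalar_mxC.
- by [].
- by [].
- by move=> r A C /=; rewrite -raddfD mulmxDl.
- by move=> r A C /=; rewrite -[_ * C]/(_ *m C) mul_scalar_mx -scalemxAl mxtraceZ.
pose x (i : 'I_(nn a).+1) : mx_trace_monoid F n :=
  if i == ord_max then e a *m (B *m e a) else h (y (val i)).
apply: (etrans (sum_perm_inv (fun p => tmono setT p x))).
apply: mx_alt0 => j; rewrite /x.
  case: eqP => _; first by rewrite mulmxA eidemM eqxx.
  by rewrite /h /= mulmxA eidemM eqxx.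
case: eqP => _; first by rewrite -!mulmxA eidemM eqxx.
by rewrite /h /= -!mulmxA eidemM eqxx.
Qed.

Lemma etrel_eeval (u w : etm F t) : etrel nn (MCH_gens nn) u w ->
  forall v, eeval nn v u = eeval nn v w.
Proof.
elim=> {u w} /=.
- by [].
- by move=> u w _ IH v; rewrite IH.
- by move=> u w x _ IH _ IH' v; rewrite IH.
- by move=> u u' w w' _ IH _ IH' v; rewrite IH IH'.
- by move=> u u' w w' _ IH _ IH' v; rewrite IH IH'.
- by move=> u u' _ IH v; rewrite IH.
- by move=> u w x v; rewrite addrA.
- by move=> u w v; rewrite addrC.
- by move=> u v; rewrite raddf0 addr0.
- by move=> u v; rewrite mul_scalar_mx scaleN1r raddf0 subrr.
- by move=> u w x v; rewrite mulmxA.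
- by move=> u v; rewrite mul1mx.
- by move=> u v; rewrite mulmx1.
- by move=> u w x v; rewrite mulmxDl.
- by move=> u w x v; rewrite mulmxDr.
- by move=> c d v; rewrite raddfD.
- by move=> c d v; rewrite -scalar_mxM.
- by move=> c u v; rewrite scalar_mxC.
- by move=> a b v; rewrite eidemM; case: eqP => //= _; rewrite raddf0.
- move=> v; rewrite -eidem_sum -big_enum /=.
  elim: (enum _) => [|a l IH] /=; first by rewrite big_nil raddf0.
  by rewrite big_cons IH.
- by move=> u w v; rewrite raddfD raddfD.
- by move=> c u v; rewrite mul_scalar_mx mxtraceZ -scalar_mxM.
- by move=> u w v; rewrite mxtrace_mulC.
- by move=> u w v; rewrite scalar_mxC.
- by move=> u w v; rewrite mul_scalar_mx mxtraceZ -scalar_mxM.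
- by move=> a v; rewrite mxtrace_eidem.
- by move=> g s [a ->] v; rewrite eeval_generator raddf0.
Qed.

End Soundness.

(** * The quotient ring of terms by the congruence *)

HB.instance Definition _ (F : fieldType) (t : nat) := gen_eqMixin (etm F t).
HB.instance Definition _ (F : fieldType) (t : nat) := gen_choiceMixin (etm F t).

Section Quotient.
Local Open Scope quotient_scope.

Variables (F : fieldType) (t : nat) (nn : 'I_t -> nat) (G : etm F t -> Prop).
Implicit Types u v w : etm F t.

Definition etrelb u v := `[< etrel nn G u v >].

Lemma etrelb_refl : reflexive etrelb.
Proof. by move=> u; apply/asboolP/er_refl. Qed.

Lemma etrelb_sym : symmetric etrelb.
Proof. by move=> u v; apply/asboolP/asboolP; apply: er_sym. Qed.

Lemma etrelb_trans : transitive etrelb.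
Proof. by move=> v u w /asboolP uv /asboolP vw; apply/asboolP/(er_trans _ _ _ _ _ uv). Qed.

Definition etrel_equiv := EquivRel etrelb etrelb_refl etrelb_sym etrelb_trans.

Definition etquot := {eq_quot etrel_equiv}.

HB.instance Definition _ := Choice.on etquot.

Definition cls u : etquot := \pi_etquot u.
Definition rep (a : etquot) : etm F t := generic_quotient.repr a.

Lemma clsP u v : cls u = cls v <-> etrel nn G u v.
Proof.
split=> [e|uv]; first by apply/asboolP; apply/(eqmodP etrel_equiv).
by apply/(eqmodP etrel_equiv)/asboolP.
Qed.

Lemma repK a : cls (rep a) = a. Proof. exact: reprK. Qed.

Lemma rep_cls u : etrel nn G (rep (cls u)) u.
Proof. by apply/clsP; rewrite repK. Qed.

Definition qadd a b := cls (EAdd (rep a) (rep b)).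
Definition qmul a b := cls (EMul (rep a) (rep b)).
Definition qopp a := cls (EMul (EConst (-1)) (rep a)).
Definition qtr a := cls (ETr (rep a)).

Lemma cls_add u v : cls (EAdd u v) = qadd (cls u) (cls v).
Proof. by apply/clsP/er_sym/er_add; apply: rep_cls. Qed.
Lemma cls_mul u v : cls (EMul u v) = qmul (cls u) (cls v).
Proof. by apply/clsP/er_sym/er_mul; apply: rep_cls. Qed.
Lemma cls_tr u : cls (ETr u) = qtr (cls u).
Proof. by apply/clsP/er_sym/er_tr; apply: rep_cls. Qed.

Lemma qaddA : associative qadd.
Proof.
move=> a b c; rewrite -(repK a) -(repK b) -(repK c) -!cls_add.
exact/clsP/er_addA.
Qed.
Lemma qaddC : commutative qadd.
Proof. by move=> a b; rewrite -(repK a) -(repK b) -!cls_add; apply/clsP/er_addC. Qed.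
Lemma qadd0 : left_id (cls (EConst 0)) qadd.
Proof. by move=> a; rewrite qaddC -(repK a) -cls_add; apply/clsP/er_add0. Qed.
Lemma qaddN : left_inverse (cls (EConst 0)) qopp qadd.
Proof. by move=> a; rewrite qaddC -{1}(repK a) -cls_add; apply/clsP/er_addN. Qed.

HB.instance Definition _ := GRing.isZmodule.Build etquot qaddA qaddC qadd0 qaddN.

Lemma qmulA : associative qmul.
Proof.
move=> a b c; rewrite -(repK a) -(repK b) -(repK c) -!cls_mul.
exact/clsP/er_mulA.
Qed.
Lemma qmul1l : left_id (cls (EConst 1)) qmul.
Proof. by move=> a; rewrite -(repK a) -cls_mul; apply/clsP/er_mul1l. Qed.
Lemma qmul1r : right_id (cls (EConst 1)) qmul.
Proof. by move=> a; rewrite -(repK a) -cls_mul; apply/clsP/er_mul1r. Qed.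
Lemma qmulDl : left_distributive qmul +%R.
Proof.
move=> a b c; rewrite -(repK a) -(repK b) -(repK c) -[_ + _]cls_add -!cls_mul.
by rewrite -[RHS]cls_add; apply/clsP/er_mulDl.
Qed.
Lemma qmulDr : right_distributive qmul +%R.
Proof.
move=> a b c; rewrite -(repK a) -(repK b) -(repK c) -[_ + _]cls_add -!cls_mul.
by rewrite -[RHS]cls_add; apply/clsP/er_mulDr.
Qed.

(** The ring may be trivial: for [t = 0] the axiom that the [E_a] add up to 1 reads 0 = 1. *)
HB.instance Definition _ :=
  GRing.Zmodule_isPzRing.Build etquot qmulA qmul1l qmul1r qmulDl qmulDr.

Lemma clsD u v : cls (EAdd u v) = cls u + cls v. Proof. exact: cls_add. Qed.
Lemma clsM u v : cls (EMul u v) = cls u * cls v. Proof. exact: cls_mul. Qed.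

Definition qconst (c : F) : etquot := cls (EConst c).
Definition qidem a : etquot := cls (EIdem a).
Definition qvar i : etquot := cls (EVar i).

Lemma qconst0 : qconst 0 = 0. Proof. by []. Qed.
Lemma qconst1 : qconst 1 = 1. Proof. by []. Qed.
Lemma qconstD c d : qconst (c + d) = qconst c + qconst d.
Proof. by rewrite -clsD; apply/clsP/er_sym/er_constD. Qed.
Lemma qconstM c d : qconst (c * d) = qconst c * qconst d.
Proof. by rewrite -clsM; apply/clsP/er_sym/er_constM. Qed.
Lemma qconst_central c a : qconst c * a = a * qconst c.
Proof. by rewrite -(repK a) -!clsM; apply/clsP/er_constC. Qed.

Lemma qconstN1 : qconst (-1) = -1.
Proof.
by apply: (addrI 1); rewrite -{1}qconst1 -qconstD !subrr qconst0.
Qed.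

Lemma qidemM a b : qidem a * qidem b = if a == b then qidem a else 0.
Proof. by rewrite -clsM; case: eqP (er_idem nn G a b) => _ /clsP. Qed.

Lemma qidem_sum : \sum_a qidem a = 1.
Proof.
rewrite -[1]/(cls EOne) -big_enum /=; have /clsP <- := er_idem_sum nn G.
elim: (enum _) => [|a l IH]; first by rewrite big_nil.
by rewrite big_cons IH -clsD.
Qed.

Lemma qtrD a b : qtr (a + b) = qtr a + qtr b.
Proof.
rewrite -(repK a) -(repK b) -clsD -!cls_tr -clsD.
exact/clsP/er_trD.
Qed.
Lemma qtr0 : qtr 0 = 0.
Proof. by apply: (addrI (qtr 0)); rewrite -qtrD !addr0. Qed.
Lemma qtrZ c a : qtr (qconst c * a) = qconst c * qtr a.
Proof. by rewrite -(repK a) -clsM -!cls_tr -clsM; apply/clsP/er_trZ. Qed.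
Lemma qtrC a b : qtr (a * b) = qtr (b * a).
Proof. by rewrite -(repK a) -(repK b) -!clsM -!cls_tr; apply/clsP/er_trC. Qed.
Lemma qtr_central a b : qtr a * b = b * qtr a.
Proof. by rewrite -(repK a) -(repK b) -!cls_tr -!clsM; apply/clsP/er_trcentral. Qed.
Lemma qtr_tr a b : qtr (qtr a * b) = qtr a * qtr b.
Proof.
rewrite -(repK a) -(repK b) -(cls_tr (rep a)) -(cls_tr (rep b)) -!clsM -cls_tr.
exact/clsP/er_trtr.
Qed.
Lemma qtr_idem a : qtr (qidem a) = qconst (nn a)%:R.
Proof. by rewrite -cls_tr; apply/clsP/er_trE. Qed.

End Quotient.

(* The formal trace of a marked word [u z v], linear in an adjoined element
   [z], is recorded as [eps * v u] in the dual numbers [C + eps R] over the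
   center [C] of [R]: this turns mixed trace monomials into pure ones. *)
Section Marker.
Variable R : pzRingType.

Definition central : pred R := fun c => `[< forall a, c * a = a * c >].

Lemma centralP c : reflect (forall a, c * a = a * c) (central c).
Proof. exact: asboolP. Qed.

Lemma central_subring : GRing.subring_closed central.
Proof.
split=> [|c d|c d]; rewrite !unfold_in => /=.
- by apply/centralP => a; rewrite mul1r mulr1.
- by move=> /centralP cc /centralP cd; apply/centralP => a; rewrite mulrBl mulrBr cc cd.
- move=> /centralP cc /centralP cd; apply/centralP => a.
  by rewrite -mulrA cd mulrA cc mulrA.
Qed.

Record center := Center { center_val :> R; centerP : central center_val }.
HB.instance Definition _ := [isSub for center_val].
HB.instance Definition _ := [Choice of center by <:].
HB.instance Definition _ := GRing.SubChoice_isSubPzRing.Build R central center central_subring.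

Lemma center_mulC : commutative (@GRing.mul center).
Proof. by move=> c d; apply/val_inj; rewrite !rmorphM; apply/centralP/centerP. Qed.
HB.instance Definition _ := GRing.PzRing_hasCommutativeMul.Build center center_mulC.

Definition dual := (center * R)%type.
HB.instance Definition _ := GRing.Zmodule.on dual.
Implicit Types x y z : dual.

Definition dual_one : dual := (1, 0).
Definition dual_mul x y : dual :=
  (x.1 * y.1, center_val x.1 * y.2 + center_val y.1 * x.2).

Lemma center_central (c : center) a : c * a = a * c :> R.
Proof. exact/centralP/centerP. Qed.

Lemma dual_mulA : associative dual_mul.
Proof.
move=> x y z; congr pair; rewrite /= ?mulrA //.
rewrite !mulrDr addrA !mulrA; congr (_ + _ + _).
  by rewrite [center_val z.1 * _]center_central.
by rewrite [center_val z.1 * _]center_central.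
Qed.
Lemma dual_mulC : commutative dual_mul.
Proof. by move=> x y; congr pair; [apply: mulrC|apply: addrC]. Qed.
Lemma dual_mul1 : left_id dual_one dual_mul.
Proof.
by case=> c a; rewrite /dual_mul /= !mul1r mulr0 addr0.
Qed.
Lemma dual_mulDl : left_distributive dual_mul +%R.
Proof.
move=> x y z; congr pair; rewrite /= ?mulrDl ?mulrDr //.
by rewrite addrACA.
Qed.
HB.instance Definition _ :=
  GRing.Zmodule_isComPzRing.Build dual dual_mulA dual_mulC dual_mul1 dual_mulDl.

Lemma dual_mulE x y :
  x * y = (x.1 * y.1, center_val x.1 * y.2 + center_val y.1 * x.2).
Proof. by []. Qed.
End Marker.

(** [Mark u v] is the word [u z v]; [Null] stands for all words with several markers, whose trace is
    0 in accordance with eps^2 = 0. *)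
Inductive marked (R : Type) := Pure of R | Mark of R & R | Null.
Arguments Null {R}.

Section MarkedMonoid.
Variables (R : pzRingType) (tr : R -> R).
Hypothesis tr_central : forall a b, tr a * b = b * tr a.
Hypothesis trC : forall a b, tr (a * b) = tr (b * a).

Definition mark_mul (x y : marked R) :=
  match x, y with
  | Pure a, Pure b => Pure (a * b)
  | Pure a, Mark u v => Mark (a * u) v
  | Mark u v, Pure b => Mark u (v * b)
  | _, _ => Null
  end.

Lemma mark_mulA : associative mark_mul.
Proof. by case=> [a|u v|] [b|u' v'|] [c|u'' v''|] //=; rewrite mulrA. Qed.
Lemma mark_mul1l : left_id (Pure 1) mark_mul.
Proof. by case=> [a|u v|] //=; rewrite mul1r. Qed.
Lemma mark_mul1r : right_id (Pure 1) mark_mul.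
Proof. by case=> [a|u v|] //=; rewrite mulr1. Qed.

Lemma tr_is_central a : central (tr a).
Proof. exact/centralP/tr_central. Qed.

Definition mark_tr (x : marked R) : dual R :=
  match x with
  | Pure a => (Center (tr_is_central a), 0)
  | Mark u v => (0, v * u)
  | Null => 0
  end.

Lemma mark_trC x y : mark_tr (mark_mul x y) = mark_tr (mark_mul y x).
Proof.
case: x y => [a|u v|] [b|u' v'|] //=; rewrite ?mulrA //.
by congr pair; apply/val_inj; rewrite /= trC.
Qed.

Definition marked_monoid : trace_monoid (dual R) :=
  TraceMonoid mark_mulA mark_mul1l mark_mul1r mark_trC.

End MarkedMonoid.

Definition is_pure R (x : marked R) := if x is Pure _ then True else False.

(** Conjugation preserves the sign, so CH is symmetric in its arguments. *)
Lemma sum_tmono_relabel (Z : comPzRingType) (M : trace_monoid Z) (I : finType)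
    (y : I -> M) (r : {perm I}) :
  \sum_(p : {perm I}) (-1) ^+ p * tmono setT p y =
  \sum_(p : {perm I}) (-1) ^+ p * tmono setT p (y \o r).
Proof.
rewrite [RHS](reindex_inj (conjg_inj r^-1%g)) /=; apply: eq_bigr => p _.
rewrite odd_permJ; congr (_ * _).
have <- := @tmono_relabel _ M _ _ r setT p (p ^ r^-1)%g y.
- congr (tmono _ _ _); apply/esym/setP => i; rewrite inE; apply/imsetP.
  by exists (r^-1 i)%g; rewrite ?permKV ?inE.
- exact: perm_inj.
- by move=> i; rewrite !inE.
- by move=> i _; rewrite conjgE invgK !permM permKV.
Qed.

(** * The alternating relation in the quotient *)

Section QuotientWorld.
Variables (F : fieldType) (t : nat) (nn : 'I_t -> nat).
Local Notation Q := (etquot nn (@MCH_gens F t nn)).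
Local Notation tr := (@qtr F t nn (MCH_gens nn)).
Local Notation e := (@qidem F t nn (MCH_gens nn)).

Definition quotient_monoid : trace_monoid (dual Q) :=
  marked_monoid (@qtr_central F t nn _) (@qtrC F t nn _).

Local Notation mkmono s x := (tmono (M := quotient_monoid) setT s x).

(** The generator is instantiated at representatives of the [z k], which absorb the idempotents put
    around the variables. *)
Lemma quotient_mch a (z : nat -> Q) : (forall k, e a * (z k * e a) = z k) ->
  e a * (ring_mch tr (nn a) z * e a) = 0.
Proof.
move=> ez; pose h u : Q := cls nn (MCH_gens nn) (esubst (fun k => rep (z k)) u).
pose y i : etm F t := EMul (EIdem a) (EMul (EVar i) (EIdem a)).
have <- : cls nn (MCH_gens nn) (esubst (fun k => rep (z k)) (corner_MCH nn a)) = 0.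
  by apply/clsP/er_gen; exists a.
rewrite -[RHS]/(h (corner_MCH nn a)) /h /= !clsM -/(h (MCH _ y)).
rewrite (eval_MCH (h := h) (tr := tr)).
- congr (_ * (ring_mch _ _ _ * _)); apply/funext => k /=.
  by rewrite /h /= !clsM repK ez.
- by move=> u v; rewrite /h clsD.
- by move=> u v; rewrite /h clsM.
- by [].
- by [].
- exact: qconstN1.
- by move=> u; rewrite /h cls_tr.
Qed.

Lemma quotient_alt0 a (y : 'I_(nn a).+1 -> quotient_monoid) :
  (forall j, tmul (Pure (e a) : quotient_monoid) (y j) = y j) ->
  (forall j, tmul (y j) (Pure (e a) : quotient_monoid) = y j) ->
  (exists k, forall j, j != k -> is_pure (y j)) ->
  \sum_(p : {perm 'I_(nn a).+1}) (-1) ^+ p * mkmono p y = 0.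
Proof.
(* The argument that may be marked is moved to the last place, which [MCH] leaves open. *)
move=> ey ye [k0 pure]; pose r := tperm k0 ord_max.
rewrite (sum_tmono_relabel y r); set x := y \o r.
have ex j : tmul (Pure (e a) : quotient_monoid) (x j) = x j by apply: ey.
have xe j : tmul (x j) (Pure (e a) : quotient_monoid) = x j by apply: ye.
have {}pure j : j != ord_max -> is_pure (x j).
  move=> jm; apply: pure; apply: contraNneq jm => /(congr1 r).
  by rewrite tpermK tpermL => ->.
move: x ex xe pure => {ey ye k0 r}x ex xe pure.
(* The default 0 can only be met when [inord k] is the last place, whose argument [MCH] does not
   read; it keeps [z k] in the corner there too. *)
pose z k : Q := if x (inord k) is Pure b then b else 0.
have ez k : e a * (z k * e a) = z k.
  rewrite /z; have := ex (inord k); have := xe (inord k).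
  case: (x _) => [b|u v|]; rewrite ?mul0r ?mulr0 //=.
  by move=> [be] [eb]; rewrite be eb.
rewrite -sum_perm_inv.
transitivity (ttr (tmul (Pure (ring_mch tr (nn a) z) : quotient_monoid) (x ord_max))).
  rewrite (@ttr_mch Q tr _ quotient_monoid (@Pure Q)) //.
  - apply: eq_bigr => p _; congr (_ * _); apply: tmono_ext => j _.
    case: eqP => [-> //|/eqP /pure]; rewrite /z inord_val.
    by case: (x j).
  - exact: qtr_central.
  - move=> [b|u' v'|] u v /=; last by rewrite addr0.
      congr pair; last by rewrite addr0.
      by apply/val_inj; rewrite /= mulrDl qtrD.
    congr pair; first by rewrite addr0.
    by rewrite mulrDl mulrDr.
  - move=> [b|u' v'|] u v; rewrite [RHS]dual_mulE /= ?mulr0 ?mul0r ?addr0 //.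
      congr pair; apply/val_inj; rewrite /= -qtr_tr.
      by rewrite mulrA.
    congr pair.
    by rewrite !mulrA -(qtr_central u v').
(* The last argument gives off an [e a] on each side; cyclicity moves both next to [MCH]. *)
rewrite -(xe ord_max) -{1}(ex ord_max).
rewrite -!tmulA; rewrite tmulA ttrC -!tmulA ttrC.
change (ttr (tmul (Pure (e a * (ring_mch tr (nn a) z * e a)) : quotient_monoid)
  (x ord_max)) = 0).
rewrite quotient_mch //; case: (x ord_max) => [b|u v|] //=.
  by congr pair; apply/val_inj; rewrite /= mul0r qtr0.
by congr pair; rewrite mul0r mulr0.
Qed.

End QuotientWorld.

(** * Transfer of multilinear identities from matrices *)

Section Relations.
Variables (Z : comPzRingType) (M : trace_monoid Z).
Variables (t : nat) (nn : 'I_t -> nat) (e : 'I_t -> M) (P : M -> Prop).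
Hypothesis Pmul : forall u v, P u -> P v -> P (tmul u v).
Hypothesis ortho : forall a b r, a != b -> ttr (tmul (tmul (e a) (e b)) r) = 0.
Hypothesis alt0 : forall a (y : 'I_(nn a).+1 -> M),
  (forall j, tmul (e a) (y j) = y j) -> (forall j, tmul (y j) (e a) = y j) ->
  (exists k, forall j, j != k -> P (y j)) ->
  \sum_(p : {perm 'I_(nn a).+1}) (-1) ^+ p * tmono setT p y = 0.

Variables (N : nat) (al be : 'I_N -> 'I_t) (x : 'I_N -> M).
Hypothesis ex : forall i, tmul (e (al i)) (x i) = x i.
Hypothesis xe : forall i, tmul (x i) (e (be i)) = x i.
(** Guarded by an index, because for [N = 0] there is no [k] to name. *)
Hypothesis Px : 'I_N -> exists k, forall i, i != k -> P (x i).

(** At an incompatible junction the product of two different idempotents appears under a trace. *)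
Lemma tmono_not_compat s : ~~ compat al be s -> tmono setT s x = 0.
Proof.
case/forallPn=> i ne_i; have st := stableT s.
have [si|si] := eqVneq (s i) i.
  rewrite (@tmono_fix _ _ _ _ _ x i) // -xe ttrC -ex tmulA ortho ?mul0r //.
  by rewrite -{2}si.
rewrite (@tmono_contract _ _ _ _ _ x i) //.
have [||c [r E]] := @tmono_at _ _ _ (setT :\ i) (s * tperm i (s i))%g (tmerge x i (s i)) (s i).
- exact: stable_contract.
- by rewrite !inE si.
rewrite E // /tmerge eqxx -xe -(ex (s i)) -!tmulA ttrC -!tmulA.
by rewrite [tmul (e (be i)) _]tmulA ortho ?mul0r.
Qed.

Lemma tmono_alternating s a (f : 'I_(nn a).+1 -> 'I_N) (f_inj : injective f) :
  (forall k, be (f k) = a) -> compat al be s ->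
  \sum_(p : {perm 'I_(nn a).+1}) tmono setT (push f_inj p * s)%g x *~ (-1) ^+ p = 0.
Proof.
move=> fa /forallP cs.
rewrite -[RHS](@antisymmetrized_tmono _ M _ _ f (e a) P ord0 f_inj Pmul (@alt0 a) setT s x).
- apply: eq_bigr => p _; case: odd_perm; rewrite ?expr1 ?expr0 ?mul1r //.
  by rewrite mulrN1z mulN1r.
- exact: stableT.
- exact: subsetT.
- by move=> j; have := xe (f j); rewrite fa.
- by move=> j; have := ex (s (f j)); rewrite -(eqP (cs (f j))) fa.
- by have [k kP] := Px (f ord0); exists k => i _; apply: kP.
Qed.

End Relations.

Section Transfer.
Variables (F : fieldType) (t : nat) (nn : 'I_t -> nat).
Local Notation n := (bsum nn).
Local Notation e := (@eidem F t nn).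
Local Notation mxmono s x := (tmono (M := mx_trace_monoid F n) setT s x).

(** Colours become matrix indices: the first component names a block, the second a place inside
    it. *)
Lemma color_index N (c : 'I_N -> 'I_t * nat) :
  (forall i, ((c i).2 < nn (c i).1)%N) ->
  exists p : 'I_N -> 'I_n, forall i, val (p i) = (offset nn (c i).1 + (c i).2)%N.
Proof.
move=> cP; have lt i : (offset nn (c i).1 + (c i).2 < n)%N.
  apply: (@leq_trans (offset nn (c i).1.+1)); first by rewrite offsetS ltn_add2l.
  by rewrite -offset_last offset_le.
by exists (fun i => Ordinal (lt i)).
Qed.

Lemma color_in_block (a : 'I_t) l : (l < nn a)%N -> in_block nn a (offset nn a + l).
Proof. by move=> ltl; rewrite /in_block leq_addr offsetS ltn_add2l. Qed.

Variables (Z : comPzRingType) (phi : {rmorphism F -> Z}) (M : trace_monoid Z).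
Variables (E : 'I_t -> M) (P : M -> Prop).
Hypothesis Pmul : forall u v, P u -> P v -> P (tmul u v).
Hypothesis ortho : forall a b r, a != b -> ttr (tmul (tmul (E a) (E b)) r) = 0.
Hypothesis alt0 : forall a (y : 'I_(nn a).+1 -> M),
  (forall j, tmul (E a) (y j) = y j) -> (forall j, tmul (y j) (E a) = y j) ->
  (exists k, forall j, j != k -> P (y j)) ->
  \sum_(p : {perm 'I_(nn a).+1}) (-1) ^+ p * tmono setT p y = 0.

(** Straightening rewrites the sum with coefficients [B] that are the same for matrices and for [M].
    Matrix units indexed by two colourings turn the hypothesis into the system of
    [good_independent], so [B] vanishes. *)
Lemma transfer N (al be : 'I_N -> 'I_t) (a : {perm 'I_N} -> F) :
  (forall x : 'I_N -> 'M[F]_n,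
     (forall i, e (al i) *m x i = x i) -> (forall i, x i *m e (be i) = x i) ->
     \sum_s a s * mxmono s x = 0) ->
  forall x : 'I_N -> M,
    (forall i, tmul (E (al i)) (x i) = x i) -> (forall i, tmul (x i) (E (be i)) = x i) ->
    ('I_N -> exists k, forall i, i != k -> P (x i)) ->
    \sum_s phi (a s) * tmono setT s x = 0.
Proof.
move=> mx0 x ex xe Px.
have /fin_all_exists[b bP] := fun s => straighten (N := N) nn al be s.
pose B u := \sum_s a s * (b s u)%:~R.
have sumB (W : comPzRingType) (psi : {rmorphism F -> W}) (L : {perm 'I_N} -> W) :
    (forall s, L s = \sum_u L u *~ b s u) ->
    \sum_s psi (a s) * L s = \sum_u psi (B u) * L u.
  move=> LE; under eq_bigr do rewrite LE mulr_sumr.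
  rewrite exchange_big; apply: eq_bigr => u _ /=.
  rewrite rmorph_sum mulr_suml; apply: eq_bigr => s _.
  by rewrite rmorphM rmorph_int -mulrzr -mulrA [_%:~R * _]mulrC.
have B0 : forall u, B u = 0.
  apply: (@good_independent N t nn al be) => [u nz|c d cP dP].
    have [s nzs] : exists s, b s u != 0.
      apply/existsP; apply: contraNT nz => /existsPn b0; apply/eqP/big1 => s _.
      by have := b0 s; rewrite negbK => /eqP->; rewrite mulr0.
    by have [+ _] := bP s; apply.
  have [|q qE] := @color_index N c; first by move=> i; have [-> ] := cP i.
  have [|p pE] := @color_index N d; first by move=> i; have [-> ] := dP i.
  have inq i : in_block nn (be i) (q i).
    by have [e1 l] := cP i; rewrite qE e1 color_in_block.
  have inp i : in_block nn (al i) (p i).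
    by have [e1 l] := dP i; rewrite pE e1 color_in_block.
  pose y i : 'M[F]_n := delta_mx (p i) (q i).
  have ey i : e (al i) *m y i = y i.
    apply/matrixP => j k; rewrite eidem_mul_left mxE.
    by case: eqP => [->|]; rewrite ?inp ?mul1r ?mulr0.
  have ye i : y i *m e (be i) = y i.
    apply/matrixP => j k; rewrite eidem_mul_right mxE andbC.
    by case: eqP => [->|]; rewrite ?inq ?mulr1 ?mul0r.
  have := mx0 y ey ye; rewrite (sumB _ idfun).
    move=> mxB; rewrite -[RHS]mxB; apply: eq_bigr => u _; congr (_ * _).
    rewrite mxmono_delta; case: forallP => [cd|/forallP/forallPn[i ne_i]].
      rewrite big1 // => i _; case: eqP => // -[]; apply/val_inj.
      by rewrite qE pE (eqP (cd i)).
    rewrite (bigD1 i) //=; case: eqP => [eqp|]; last by rewrite mul0r.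
    case/negP: ne_i; have [ci lc] := cP i; have [du ld] := dP (u i).
    have a_eq : be i = al (u i).
      by apply: (@in_block_uniq _ nn _ _ (q i)) => //; rewrite eqp.
    move/(congr1 val): eqp; rewrite qE pE /= ci du a_eq => /addnI eq2.
    by apply/eqP; move: ci du eq2; case: (c i) => ? ?; case: (d _) => ? ? /= -> -> ->; rewrite a_eq.
  move=> s; have [_ bE] := bP s; apply: bE.
  - move=> u; apply: (tmono_not_compat (M := mx_trace_monoid F n) (e := e)) => //.
    by move=> a' b' r /negPf ab; rewrite /= eidemM ab mul0mx raddf0.
  - move=> u a' f f_inj fa cu.
    apply: (@tmono_alternating _ (mx_trace_monoid F n) _ nn e (fun=> True)
      _ _ _ al be y) => //.
      by move=> a1 z ez ze _; apply: mx_alt0.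
    by move=> i; exists i.
rewrite sumB; first by rewrite big1 // => u _; rewrite B0 rmorph0 mul0r.
move=> s; have [_ bE] := bP s; apply: bE.
- move=> u; apply: (tmono_not_compat ortho ex xe).
- by move=> u a' f f_inj fa cu; apply: (tmono_alternating Pmul alt0 ex xe Px).
Qed.

End Transfer.

(** * Polarization in characteristic zero *)

Lemma poly_vanishing (F : fieldType) (p : {poly F}) :
  [pchar F] =i pred0 -> (forall c, p.[c] = 0) -> p = 0.
Proof.
move=> /pcharf0P F0 p0; apply/eqP/negPn/negP => nz.
pose rs : seq F := [seq i%:R | i <- iota 0 (size p)].
have /max_poly_roots : p != 0 := nz.
move=> /(_ rs); rewrite size_map size_iota ltnn => h.
suff: false by []; apply: h; first by apply/allP => c _; apply/rootP.
have natr_le i j : (i <= j)%N -> i%:R = j%:R :> F -> i = j.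
  move=> ij e; apply/eqP; rewrite eqn_leq ij /= -subn_eq0 -F0 natrB //.
  by rewrite e subrr.
rewrite map_inj_uniq ?iota_uniq // => i j e.
by case/orP: (leq_total i j) => /natr_le; [apply|move=> /(_ (esym e))].
Qed.

Lemma base_digits_uniq B m (a b : nat -> nat) :
  (forall c, (a c < B)%N) -> (forall c, (b c < B)%N) ->
  (\sum_(c < m) a c * B ^ c = \sum_(c < m) b c * B ^ c)%N ->
  forall c, (c < m)%N -> a c = b c.
Proof.
elim: m a b => [|m IH] a b aB bB //; rewrite !big_ord_recl !expn0 !muln1.
have shift (d : nat -> nat) : (\sum_(c < m) d (lift ord0 c) * B ^ lift ord0 c =
    (\sum_(c < m) d c.+1 * B ^ c) * B)%N.
  by rewrite big_distrl; apply: eq_bigr => c _; rewrite /= expnSr mulnA.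
rewrite !shift => e.
have e0 : a 0%N = b 0%N.
  have := congr1 (modn^~ B) e.
  by rewrite /= ![(_ 0%N + _)%N]addnC !modnMDl !modn_small.
have B_gt0 : (0 < B)%N by apply: leq_ltn_trans (aB 0%N).
move: e; rewrite e0 => /addnI/eqP; rewrite eqn_pmul2r // => /eqP e [|c] //.
exact: (IH (a \o succn) (b \o succn) (fun k => aB k.+1) (fun k => bB k.+1) e c).
Qed.

(** As [m' < B], the sizes of the fibres of [h] are the base [B] digits of the left side; by
    comparison with the right side they all equal 1. *)
Lemma sum_expn_bijective B m m' (h : 'I_m' -> 'I_m) : (m' < B)%N -> (1 < B)%N ->
  (\sum_i B ^ h i = \sum_(c < m) B ^ c)%N -> m' = m /\ injective h.
Proof.
move=> m'B B1; rewrite (partition_big h predT) //= => e.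
pose a c := #|[set i | val (h i) == c]|.
have a1 (c : 'I_m) : a c = 1%N.
  apply: (@base_digits_uniq B m a (fun=> 1%N)) => // [d|].
    by apply: leq_ltn_trans m'B; rewrite -[leqRHS]card_ord max_card.
  under [RHS]eq_bigr do rewrite mul1n.
  rewrite -e; apply: eq_bigr => d _.
  rewrite (eq_bigr (fun=> (B ^ d)%N)) => [|i /eqP-> //].
  by rewrite sum_nat_const; congr (_ * _)%N; apply: eq_card => i; rewrite inE.
split.
  rewrite -[LHS]card_ord -[RHS]card_ord -!sum1_card (partition_big h predT) //=.
  apply: eq_bigr => d _; rewrite sum1dep_card -(a1 d).
  by apply: eq_card => i; rewrite !inE.
move=> i j hij; have /eqP/cards1P[k ak] := a1 (h i).
have: i \in [set i' | val (h i') == h i] by rewrite inE.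
have: j \in [set i' | val (h i') == h i] by rewrite inE hij.
by rewrite ak !inE => /eqP-> /eqP->.
Qed.

(** The permutation is [next] in the list containing the point and the identity elsewhere; [prev]
    gives its inverse. *)
Lemma perm_of_cycles (I : finType) (cs : seq (seq I)) :
  uniq (flatten cs) -> exists s : {perm I}, all (fcycle s) cs.
Proof.
pose g step cs x : I := foldr (fun (c : seq I) y => if x \in c then step c x else y) x cs.
have gP step ds x : (forall c y, y \in c -> step c y \in c) ->
    if x \in flatten ds then is_true (g step ds x \in flatten ds) else g step ds x = x.
  move=> stepP; elim: ds => //= c ds IH; rewrite mem_cat.
  case: (boolP (x \in c)) => xc /=; first by rewrite mem_cat stepP.
  by move: IH; case: ifP => // _ H; rewrite mem_cat H orbT.
have nextP (c : seq I) y : y \in c -> next c y \in c by rewrite mem_next.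
have K ds : uniq (flatten ds) -> cancel (g (@next I) ds) (g (@prev I) ds).
  elim: ds => [//|c ds IH] /=; rewrite cat_uniq => /and3P[Uc /hasPn dis U] x /=.
  case: (boolP (x \in c)) => xc; first by rewrite mem_next xc prev_next.
  have := gP _ ds x nextP; case: ifP => [_ /dis /negPf /= ->|_ e]; first exact: IH.
  by rewrite e (negPf xc) -[in RHS](IH U x) e.
move=> U; exists (perm (can_inj (K _ U))); apply/allP => c ccs.
have Uc : uniq c.
  elim: (cs) U ccs => //= d ds IH; rewrite cat_uniq inE.
  by case/and3P=> Ud _ /IH{}IH /orP[/eqP->|/IH].
have Pc : all [in c] c by apply/allP.
apply: sub_in_cycle Pc (cycle_next Uc) => x y xc _ /= /eqP <-.
rewrite permE; apply/eqP.
elim: (cs) U ccs => //= d ds IH; rewrite inE cat_uniq => /and3P[_ /hasPn dis U].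
case/orP=> [/eqP <-|cds]; first by rewrite xc.
case: ifP => xd; last exact: IH.
have xds : x \in flatten ds by apply/flattenP; exists c.
by have := dis x xds; rewrite /= xd.
Qed.

Section WordPermutation.
Variables (L : Type) (l0 : L) (m : nat).
Implicit Types ws : seq (seq L).

(** The letters of all words are numbered consecutively; the interval occupied by a word becomes a
    cycle of [word_perm]. *)
Definition positions ws : seq (seq 'I_m) := reshape (shape ws) (enum 'I_m).

Definition letter_at ws (i : 'I_m) : L := nth l0 (flatten ws) i.

Definition word_perm ws : {perm 'I_m} :=
  odflt 1%g [pick s : {perm 'I_m} | all (fcycle s) (positions ws)].

Lemma prod_words_tmono ws : size (flatten ws) = m -> all (fun w => 0 < size w)%N ws ->
  forall (Z : comPzRingType) (M : trace_monoid Z) (rho : L -> M),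
  \prod_(w <- ws) ttr (tword rho w) =
  tmono setT (word_perm ws) (rho \o letter_at ws).
Proof.
move=> sz nonnil Z M rho.
have sh : size (enum 'I_m) = sumn (shape ws) by rewrite size_enum_ord -sz size_flatten.
have flat : flatten (positions ws) = enum 'I_m by rewrite reshapeKr ?sh.
have E : map (map (letter_at ws)) (positions ws) = ws.
  rewrite /positions map_reshape -[RHS]flattenK; congr reshape.
  apply: (@eq_from_nth _ l0); first by rewrite size_map size_enum_ord sz.
  move=> i; rewrite size_map size_enum_ord => im.
  by rewrite (nth_map (Ordinal im)) ?size_enum_ord // /letter_at nth_enum_ord.
have cycs : all (fcycle (word_perm ws)) (positions ws).
  rewrite /word_perm; case: pickP => [s //|no].
  have [|s sP] := @perm_of_cycles _ (positions ws); first by rewrite flat enum_uniq.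
  by have := no s; rewrite sP.
rewrite (@tmono_cycles _ _ _ _ _ _ (positions ws)); last first.
  split=> //; first by rewrite flat enum_uniq.
    by apply/negP => nilp; move: nonnil; rewrite -E all_map => /allP/(_ _ nilp).
  by move=> i; rewrite flat inE mem_enum.
rewrite -{1}E big_map; apply: eq_bigr => c _.
by rewrite tword_map.
Qed.

End WordPermutation.

Section Polarization.
Variables (F : fieldType) (F0 : [pchar F] =i pred0) (t : nat) (nn : 'I_t -> nat).
Local Notation n := (bsum nn).
Local Notation e := (@eidem F t nn).
Local Notation mxmono s x := (tmono (M := mx_trace_monoid F n) setT s x).

(** [(v, a, b)] stands for the variable [x_v] enclosed by idempotents, E_a x_v E_b. *)
Definition letter := (nat * 'I_t * 'I_t)%type.

Definition mx_letter (X : nat -> 'M[F]_n) (l : letter) : 'M[F]_n :=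
  e l.1.2 *m X l.1.1 *m e l.2.

Variables (l0 : letter) (K : seq (F * seq (seq letter))).
Hypothesis K_words : forall k, k \in K -> all (fun w => 0 < size w)%N k.2.
Hypothesis K_identity : forall X, \sum_(k <- K) k.1 *
  \prod_(w <- k.2) ttr (tword (M := mx_trace_monoid F n) (mx_letter X) w) = 0.

Local Notation deg k := (size (flatten k.2)).

Lemma mx_letter_sum (I : finType) (c : I -> F) (Y : I -> nat -> 'M[F]_n) l :
  mx_letter (fun v => \sum_d c d *: Y d v) l = \sum_d c d *: mx_letter (Y d) l.
Proof.
rewrite /mx_letter mulmx_sumr mulmx_suml; apply: eq_bigr => d _.
by rewrite -scalemxAr -scalemxAl.
Qed.

Lemma sum_injective_perm (m : nat) (f : {ffun 'I_m -> 'I_m} -> F) :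
  \sum_(h : {ffun 'I_m -> 'I_m} | injectiveb h) f h =
  \sum_(h : {perm 'I_m}) f (pval h).
Proof.
rewrite (reindex (@pval 'I_m)) /=; first by apply: eq_bigl => -[h hinj].
exists (insubd (1%g : {perm 'I_m})) => [p _|h hinj]; first exact: valKd.
exact: (insubdK _ hinj).
Qed.

(* Substitute [sum_d c ^ (B ^ d) Y_d] for the variables, where [B] exceeds all
   degrees: by uniqueness of base [B] digits, the coefficient of
   [c ^ (sum_d B ^ d)] collects the terms in which each [Y_d] occurs once. *)
Lemma polarized_identity m (Y : 'I_m -> nat -> 'M[F]_n) :
  \sum_(k <- K | deg k == m) k.1 * \sum_(h : {perm 'I_m})
    mxmono (word_perm m k.2) (fun i => mx_letter (Y (h i)) (letter_at l0 k.2 i)) = 0.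
Proof.
(* [.+2] puts [B] above all degrees and also above 1 when every degree is 0. *)
pose B := (\max_(k <- K) deg k).+2.
have degB k : k \in K -> (deg k < B)%N.
  by move=> kK; rewrite ltnS ltnW // ltnS (@leq_bigmax_seq _ K xpredT (fun k => deg k)).
pose wt m' (h : {ffun 'I_m' -> 'I_m}) := (\sum_i B ^ h i)%N.
pose w0 := (\sum_(d < m) B ^ d)%N.
pose cf (k : F * seq (seq letter)) m' (h : {ffun 'I_m' -> 'I_m}) : F :=
  k.1 * mxmono (word_perm m' k.2) (fun i => mx_letter (Y (h i)) (letter_at l0 k.2 i)).
pose p : {poly F} := \sum_(k <- K) \sum_(h : {ffun 'I_(deg k) -> 'I_m})
  cf k (deg k) h *: 'X^(wt _ h).
have p0 : p = 0.
  apply: poly_vanishing => // c; pose X v := \sum_(d < m) c ^+ (B ^ d)%N *: Y d v.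
  rewrite -(K_identity X) horner_sum !big_seq; apply: eq_bigr => k kK.
  rewrite (prod_words_tmono l0 erefl (K_words kK)) horner_sum.
  have -> : mx_letter X \o letter_at l0 k.2 = fun i : 'I_(deg k) =>
      \sum_(d < m) c ^+ (B ^ d)%N *: mx_letter (Y d) (letter_at l0 k.2 i).
    by apply/funext => i; rewrite /= mx_letter_sum.
  rewrite mxmono_sum mulr_sumr; apply: eq_bigr => h _.
  rewrite hornerZ hornerXn mxmono_scale /cf -mulrA; congr (_ * _).
  by rewrite mulrC; congr (_ * _); rewrite prodrXr.
have := congr1 (fun q : {poly F} => q`_w0) p0; rewrite coef0 coef_sum => coef_p.
rewrite -[RHS]coef_p big_mkcond !big_seq; apply: eq_bigr => k kK.
rewrite coef_sum.
have wt_inj m' (h : {ffun 'I_m' -> 'I_m}) : (m' < B)%N -> wt m' h = w0 -> m' = m /\ injective h.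
  by move=> m'B; apply: sum_expn_bijective.
move: (degB k kK); move: (deg k) => m' m'B.
case: eqP => [em|ne]; last first.
  rewrite big1 // => h _; rewrite coefZ coefXn.
  by case: eqP => [/esym/(wt_inj _ _ m'B)[]//|_]; rewrite ?mulr0.
rewrite em in m'B *.
rewrite mulr_sumr; transitivity (\sum_(h : {ffun 'I_m -> 'I_m} | injectiveb h) cf k m h).
  by rewrite sum_injective_perm; apply: eq_bigr => h _; congr (_ * mxmono _ _); apply/funext => i; rewrite pvalE.
rewrite big_mkcond; apply: eq_bigr => h _; rewrite coefZ coefXn.
case: injectiveP => [h_inj|h_ninj].
  suff -> : w0 = wt m h by rewrite eqxx mulr1.
  by rewrite /w0 (reindex_inj h_inj).
by case: eqP => [/esym/(wt_inj _ _ m'B)[]//|_]; rewrite mulr0.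
Qed.

(** Substituting an element of one corner for a single variable singles out one letter: other
    variables become 0, other idempotents annihilate [y]. *)
Lemma mx_letter_typed G (y : 'M[F]_n) l :
  e G.1.2 *m y = y -> y *m e G.2 = y ->
  mx_letter (fun v => if v == G.1.1 then y else 0) l = (l == G)%:R *: y.
Proof.
case: l G => [[v a] b] [[v' a'] b'] /= ey ye; rewrite /mx_letter /= !xpair_eqE.
case: (v == v'); last by rewrite mulmx0 mul0mx scale0r.
rewrite -{1}ey -{1}ye !mulmxA eidemM.
case: (eqVneq a a') => [->|_]; last by rewrite !mul0mx scale0r.
rewrite -!mulmxA eidemM eq_sym.
case: (eqVneq b b') => [_|_]; last by rewrite !mulmx0 scale0r.
by rewrite ye ey scale1r.
Qed.

Variables (Z : comPzRingType) (phi : {rmorphism F -> Z}) (M : trace_monoid Z).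
Variables (E : 'I_t -> M) (P : M -> Prop).
Hypothesis Pmul : forall u v, P u -> P v -> P (tmul u v).
Hypothesis ortho : forall a b r, a != b -> ttr (tmul (tmul (E a) (E b)) r) = 0.
Hypothesis alt0 : forall a (y : 'I_(nn a).+1 -> M),
  (forall j, tmul (E a) (y j) = y j) -> (forall j, tmul (y j) (E a) = y j) ->
  (exists k, forall j, j != k -> P (y j)) ->
  \sum_(p : {perm 'I_(nn a).+1}) (-1) ^+ p * tmono setT p y = 0.
Variable rho : letter -> M.
Hypothesis rho_left : forall l, tmul (E l.1.2) (rho l) = rho l.
Hypothesis rho_right : forall l, tmul (rho l) (E l.2) = rho l.

Section FixedDegree.
Variable m : nat.
Local Notation wp k := (word_perm m k.2).
Local Notation la k := (@letter_at _ l0 m k.2).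
Implicit Types (G : {ffun 'I_m -> letter}) (h : {perm 'I_m}).

Lemma tmono_conj (W : comPzRingType) (M' : trace_monoid W) s h (x : 'I_m -> M') :
  tmono setT s (x \o h) = tmono setT (s ^ h)%g x.
Proof.
rewrite -(@tmono_relabel _ M' _ _ h setT (s ^ h)%g s) //.
- congr (tmono _ _ _); apply/setP => i; rewrite [RHS]inE; apply/imsetP.
  by exists (h^-1 i)%g; rewrite ?permKV ?inE.
- exact: perm_inj.
- by move=> i _; rewrite permJ.
Qed.

(** [G] prescribes a letter for each of the [m] multilinear slots. In the polarized identity only
    those [h] survive that match the letters of a monomial with [G]; the resulting multilinear
    identity, with coefficients [a], is transferred to [M] and evaluated at the [rho (G i)]. *)
Lemma transferred_identity G :
  ('I_m -> exists k, forall i, i != k -> P (rho (G i))) ->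
  \sum_(k <- K | deg k == m) phi k.1 *
    \sum_(h : {perm 'I_m} | [forall i, la k i == G (h i)]) tmono setT (wp k) (rho \o la k) = 0.
Proof.
move=> adm.
pose a s : F := \sum_(k <- K | deg k == m) k.1 *
  \sum_(h : {perm 'I_m} | [forall i, la k i == G (h i)]) ((wp k ^ h)%g == s)%:R.
have sum_a (W : comPzRingType) (psi : {rmorphism F -> W}) (T : {perm 'I_m} -> W) :
    \sum_s psi (a s) * T s = \sum_(k <- K | deg k == m) psi k.1 *
      \sum_(h : {perm 'I_m} | [forall i, la k i == G (h i)]) T (wp k ^ h)%g.
  under eq_bigr do rewrite rmorph_sum mulr_suml.
  rewrite exchange_big; apply: eq_bigr => k _ /=.
  under eq_bigr do rewrite rmorphM rmorph_sum -mulrA mulr_suml.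
  rewrite -mulr_sumr exchange_big; congr (_ * _); apply: eq_bigr => h _ /=.
  rewrite (bigD1 (wp k ^ h)%g) //= eqxx rmorph1 mul1r big1 ?addr0 // => s.
  by rewrite eq_sym => /negPf->; rewrite rmorph0 mul0r.
have := @transfer F t nn Z phi M E P Pmul ortho alt0 m
  (fun i => (G i).1.2) (fun i => (G i).2) a _ (rho \o G) _ _ adm.
rewrite sum_a => H; rewrite -[RHS]H.
- apply: eq_bigr => k _; congr (_ * _); apply: eq_bigr => h /forallP lG.
  rewrite -tmono_conj; congr (tmono _ _ _); apply/funext => i /=.
  by rewrite (eqP (lG i)).
- move=> y ey ye; rewrite (sum_a _ idfun).
  rewrite -[RHS](polarized_identity (fun d v => if v == (G d).1.1 then y d else 0)).
  apply: eq_bigr => k _; congr (_ * _); rewrite big_mkcond; apply: eq_bigr => h _ /=.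
  have -> : (fun i => mx_letter (fun v => if v == (G (h i)).1.1 then y (h i) else 0) (la k i)) =
      fun i => (la k i == G (h i))%:R *: y (h i).
    by apply/funext => i; rewrite mx_letter_typed.
  rewrite mxmono_scale (tmono_conj (M' := mx_trace_monoid F n) _ _ y).
  case: forallP => [lG|/forallP/forallPn[i /negPf lG]].
    by rewrite big1 ?mul1r // => i _; rewrite lG.
  by rewrite (bigD1 i) //= lG !mul0r.
- by move=> i; apply: rho_left.
- by move=> i; apply: rho_right.
Qed.

Hypothesis adm : forall k, k \in K -> exists j0, forall j, (j < deg k)%N -> j != j0 ->
  P (rho (nth l0 (flatten k.2) j)).

(** Restitution: a monomial [k] and a permutation [h] match exactly one [G], namely [inv k h].
    Summed over all [G], the transferred identities count each monomial [m!] times, and [m!] is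
    invertible. *)
Lemma fixed_degree_identity : \sum_(k <- K | deg k == m) phi k.1 *
  \prod_(w <- k.2) ttr (tword rho w) = 0.
Proof.
pose inv (k : F * seq (seq letter)) (h : {perm 'I_m}) : {ffun 'I_m -> letter} :=
  [ffun i => la k (h^-1 i)%g].
pose Gs := undup [seq inv k h | k <- [seq k <- K | deg k == m], h <- enum {: {perm 'I_m}}].
have inGs k h : k \in K -> deg k == m -> inv k h \in Gs.
  move=> kK dk; rewrite mem_undup; apply/allpairsP; exists (k, h).
  by rewrite /= mem_filter dk kK mem_enum.
have inv_eq k h G : [forall i, la k i == G (h i)] = (G == inv k h).
  apply/forallP/eqP => [lG|-> i]; last by rewrite ffunE permK.
  by apply/ffunP => i; rewrite ffunE (eqP (lG _)) permKV.
have sum0 : \sum_(G <- Gs) \sum_(k <- K | deg k == m) phi k.1 *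
    \sum_(h : {perm 'I_m} | [forall i, la k i == G (h i)]) tmono setT (wp k) (rho \o la k) = 0.
  rewrite big_seq big1 // => G; rewrite mem_undup => /allpairsP[[k h] /= []].
  rewrite mem_filter => /andP[/eqP dk kK] _ GE; apply: transferred_identity => i0.
  have [j0 admk] := adm kK; rewrite dk in admk.
  have [j0m|j0m] := ltnP j0 m; [exists (h (Ordinal j0m))|exists i0] => i ne_i.
    rewrite GE ffunE; apply: admk => //; apply: contraNneq ne_i => e0.
    by rewrite -[i](permKV h); apply/eqP; congr (h _); apply/val_inj.
  rewrite GE ffunE; apply: admk => //; apply: contraTneq j0m => <-.
  by rewrite -ltnNge.
have fact_ne0 : (m`!)%:R != 0 :> F.
  by move/pcharf0P: F0 => ->; rewrite -lt0n fact_gt0.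
have : phi (m`!)%:R * (\sum_(k <- K | deg k == m) phi k.1 *
    \prod_(w <- k.2) ttr (tword rho w)) = 0.
  rewrite -[RHS]sum0 exchange_big mulr_sumr /=.
  rewrite big_seq_cond [RHS]big_seq_cond; apply: eq_bigr => k /andP[kK dk].
  rewrite -mulr_sumr mulrCA; congr (_ * _).
  rewrite (prod_words_tmono l0 (eqP dk) (K_words kK)).
  set T := tmono _ _ _.
  rewrite (exchange_big_dep xpredT) //=.
  rewrite (eq_bigr (fun=> T)) => [|h _].
    by rewrite rmorph_nat sumr_const -[RHS]mulr_natl -(card_Sn m).
  rewrite (eq_bigl (pred1 (inv k h))) => [|G]; last exact: inv_eq.
  by rewrite -big_filter filter_pred1_uniq ?undup_uniq ?inGs // big_seq1.
move/(congr1 (fun c => phi (m`!%:R)^-1 * c)).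
by rewrite mulrA -rmorphM mulVf // rmorph1 mul1r mulr0.
Qed.

End FixedDegree.

Theorem polarization :
  (forall k, k \in K -> exists j0, forall j, (j < deg k)%N -> j != j0 ->
     P (rho (nth l0 (flatten k.2) j))) ->
  \sum_(k <- K) phi k.1 * \prod_(w <- k.2) ttr (tword rho w) = 0.
Proof.
move=> adm; pose D := (\max_(k <- K) deg k).+1.
rewrite (eq_big_seq (fun k => \sum_(m < D | deg k == m)
    phi k.1 * \prod_(w <- k.2) ttr (tword rho w))) => [|k kK].
  rewrite (exchange_big_dep xpredT) //= big1 // => m _.
  exact: fixed_degree_identity.
have dk : (deg k < D)%N by rewrite ltnS (@leq_bigmax_seq _ K xpredT (fun k => deg k)).
by rewrite (big_pred1 (Ordinal dk)).
Qed.

End Polarization.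

(** * Normal forms in the quotient *)

Section NormalForm.
Variables (F : fieldType) (t : nat) (nn : 'I_t -> nat) (G : etm F t -> Prop).
Local Notation Q := (etquot nn G).
Local Notation tr := (@qtr F t nn G).
Local Notation e := (@qidem F t nn G).
Local Notation const := (@qconst F t nn G).
Implicit Types (p q r : 'I_t) (a b : Q) (w : seq (letter t)) (ws : seq (seq (letter t))).

Definition qletter (l : letter t) : Q := e l.1.2 * qvar nn G l.1.1 * e l.2.

Definition qword w : Q := \prod_(l <- w) qletter l.

Definition qtraces ws : Q := \prod_(w <- ws) tr (qword w).

Definition qmono p q (k : seq (letter t) * seq (seq (letter t))) : Q :=
  qtraces k.2 * (e p * qword k.1 * e q).

(** Words under traces are kept nonempty so that permutations can encode them; the word outside may
    be empty, since the marker will be joined to it. *)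
Definition normal_form p q a :=
  exists K : seq (F * (seq (letter t) * seq (seq (letter t)))),
    (forall k, k \in K -> all (fun w => 0 < size w)%N k.2.2) /\
    a = \sum_(k <- K) const k.1 * qmono p q k.2.

Lemma qidem_idem p : e p * e p = e p.
Proof. by rewrite qidemM eqxx. Qed.

Lemma qtraces_central ws a : qtraces ws * a = a * qtraces ws.
Proof.
rewrite /qtraces; elim: ws => [|w ws IH]; first by rewrite big_nil mul1r mulr1.
by rewrite big_cons -mulrA IH mulrA qtr_central mulrA.
Qed.

Lemma qtr_traces ws a : tr (qtraces ws * a) = qtraces ws * tr a.
Proof.
rewrite /qtraces; elim: ws => [|w ws IH]; first by rewrite big_nil !mul1r.
by rewrite big_cons -mulrA qtr_tr IH mulrA.
Qed.

Lemma normal_form0 p q : normal_form p q 0.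
Proof. by exists [::]; rewrite big_nil. Qed.

Lemma normal_formD p q a b :
  normal_form p q a -> normal_form p q b -> normal_form p q (a + b).
Proof.
move=> [K [Kw ->]] [K' [K'w ->]]; exists (K ++ K'); rewrite big_cat; split=> // k.
by rewrite mem_cat => /orP[/Kw|/K'w].
Qed.

Lemma normal_formZ p q c a : normal_form p q a -> normal_form p q (const c * a).
Proof.
move=> [K [Kw ->]]; exists [seq (c * k.1, k.2) | k <- K]; split.
  by move=> _ /mapP[k kK ->]; apply: (Kw k).
rewrite big_map mulr_sumr; apply: eq_bigr => k _.
by rewrite qconstM mulrA.
Qed.

Lemma normal_form_sum p q (I : eqType) (s : seq I) (f : I -> Q) :
  (forall i, i \in s -> normal_form p q (f i)) -> normal_form p q (\sum_(i <- s) f i).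
Proof.
elim: s => [|i s IH] sP; first by rewrite big_nil; apply: normal_form0.
rewrite big_cons; apply: normal_formD; first by apply: sP; rewrite mem_head.
by apply: IH => j js; apply: sP; rewrite inE js orbT.
Qed.

Lemma normal_form_mono p q k :
  all (fun w => 0 < size w)%N k.2 -> normal_form p q (qmono p q k).
Proof.
move=> kw; exists [:: (1, k)]; rewrite big_seq1 qconst1 mul1r; split=> //.
by move=> k' /[!inE]/eqP->.
Qed.

Lemma qletter_left p l : e p * qletter l = if p == l.1.2 then qletter l else 0.
Proof.
rewrite /qletter !mulrA qidemM; case: (eqVneq p l.1.2) => [->|_] //.
by rewrite !mul0r.
Qed.

Lemma qletter_right r l : qletter l * e r = if l.2 == r then qletter l else 0.
Proof.
rewrite /qletter -!mulrA qidemM; case: (eqVneq l.2 r) => // _.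
by rewrite !mulr0.
Qed.

(** At the junction [e r] meets the last letter of the left word, or [e p] if that word is empty; it
    is absorbed or the product vanishes. *)
Lemma normal_formM p r q a b :
  normal_form p r a -> normal_form r q b -> normal_form p q (a * b).
Proof.
move=> [K [Kw ->]] [K' [K'w ->]]; rewrite mulr_suml.
apply: normal_form_sum => -[c [w ws]] /Kw /= wsP; rewrite -mulrA.
apply: normal_formZ; rewrite mulr_sumr.
apply: normal_form_sum => -[c' [w' ws']] /K'w /= ws'P.
rewrite mulrA -qconst_central -mulrA; apply: normal_formZ.
have -> : qmono p r (w, ws) * qmono r q (w', ws') =
    qtraces (ws ++ ws') * (e p * (qword w * e r) * (qword w' * e q)).
  rewrite /qmono /= /qtraces big_cat /= -/(qtraces ws) -/(qtraces ws').
  rewrite -[LHS]mulrA [_ * (qtraces ws' * _)]mulrA -(qtraces_central ws').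
  by rewrite -!mulrA [e r * (e r * _)]mulrA qidem_idem.
have wsP' : all (fun w => 0 < size w)%N (ws ++ ws') by rewrite all_cat wsP.
case/lastP: w => [|w l].
  rewrite [qword [::]]/qword big_nil mul1r qidemM; case: (eqVneq p r) => _.
    have := @normal_form_mono p q (w', ws ++ ws') wsP'.
    by rewrite /qmono /= !mulrA.
  by rewrite mul0r mulr0; apply: normal_form0.
have qwE : qword (rcons w l) = qword w * qletter l.
  by rewrite /qword -cats1 big_cat /= big_seq1.
rewrite qwE -[_ * _ * e r]mulrA qletter_right; case: (eqVneq l.2 r) => _.
  have := @normal_form_mono p q (rcons w l ++ w', ws ++ ws') wsP'.
  rewrite /qmono /= [qword (_ ++ _)]/qword big_cat /= -/(qword _) -/(qword _).
  by rewrite qwE !mulrA.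
by rewrite !mulr0 mul0r mulr0; apply: normal_form0.
Qed.

(** Only the diagonal corners contribute to a trace. An empty word appears there as tr(e_r), which
    is the scalar [nn r]. *)
Lemma normal_form_tr p q a :
  (forall r, normal_form r r (e r * a * e r)) -> normal_form p q (e p * tr a * e q).
Proof.
move=> nf; have -> : tr a = \sum_r tr (e r * a * e r).
  rewrite -{1}[a]mul1r -(qidem_sum nn G) mulr_suml.
  rewrite (big_morph tr (@qtrD _ _ _ _) (@qtr0 _ _ _ _)).
  by apply: eq_bigr => r _; rewrite [RHS]qtrC mulrA qidem_idem.
rewrite mulr_sumr mulr_suml -big_enum /=; apply: normal_form_sum => r _.
have [K [Kw ->]] := nf r.
rewrite (big_morph tr (@qtrD _ _ _ _) (@qtr0 _ _ _ _)) mulr_sumr mulr_suml.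
apply: normal_form_sum => -[c [w ws]] /Kw /= wsP.
rewrite qtrZ mulrA -qconst_central -!mulrA; apply: normal_formZ.
rewrite /qmono qtr_traces /=; set T := tr _.
have -> : e p * (qtraces ws * T * e q) = qtraces ws * (T * (e p * e q)).
  rewrite -mulrA [LHS]mulrA -qtraces_central -mulrA; congr (_ * _).
  by rewrite mulrA -qtr_central mulrA.
rewrite {}/T qtrC [e r * (e r * _)]mulrA qidem_idem; case: w => [|l w].
  rewrite /qword big_nil mulr1 qtr_idem mulrA -qconst_central -mulrA.
  apply: normal_formZ; have := @normal_form_mono p q ([::], ws) wsP.
  by rewrite /qmono /qword /= big_nil mulr1.
have qwE : qword (l :: w) = qletter l * qword w by rewrite /qword big_cons.
rewrite qwE [e r * _]mulrA qletter_left; case: (eqVneq r l.1.2) => _.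
  have := @normal_form_mono p q ([::], (l :: w) :: ws) wsP.
  rewrite /qmono /qtraces /= big_cons -/(qtraces ws) qwE.
  by rewrite [qword [::]]/qword big_nil mulr1 -qtraces_central -mulrA.
by rewrite mul0r qtr0 mul0r mulr0; apply: normal_form0.
Qed.

Lemma normal_form_exists u p q : normal_form p q (e p * cls nn G u * e q).
Proof.
have nf1 p' q' : normal_form p' q' (e p' * e q').
  have := @normal_form_mono p' q' ([::], [::]) isT.
  by rewrite /qmono /qword /qtraces !big_nil /= mul1r mulr1.
elim: u p q => [v|a|c|u IHu w IHw|u IHu w IHw|u IHu] p q.
- have := @normal_form_mono p q ([:: (v, p, q)], [::]) isT.
  rewrite /qmono /qword /qtraces big_seq1 big_nil /= mul1r /qletter /=.
  by rewrite !mulrA qidem_idem -[_ * e q * e q]mulrA qidem_idem.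
- rewrite -[cls _ _ _]/(e a) -mulrA qidemM; case: (eqVneq a q) => [->|_].
    exact: nf1.
  by rewrite mulr0; apply: normal_form0.
- rewrite -[cls _ _ _]/(const c) -qconst_central -mulrA.
  exact: normal_formZ.
- by rewrite clsD mulrDr mulrDl; apply: normal_formD.
- have -> : e p * cls nn G (EMul u w) * e q =
      \sum_r (e p * cls nn G u * e r) * (e r * cls nn G w * e q).
    rewrite clsM -{1}[cls nn G u]mulr1 -(qidem_sum nn G) mulr_sumr mulr_suml.
    rewrite mulr_sumr mulr_suml; apply: eq_bigr => r _.
    by rewrite -!mulrA [e r * (e r * _)]mulrA qidem_idem.
  rewrite -big_enum; apply: normal_form_sum => r _.
  exact: normal_formM.
- by rewrite cls_tr; apply: normal_form_tr => r.
Qed.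

End NormalForm.

(** * Evaluation of the quotient, and the conclusion *)

Section Evaluation.
Variables (F : fieldType) (t : nat) (nn : 'I_t -> nat).
Local Notation n := (bsum nn).
Local Notation Q := (etquot nn (@MCH_gens F t nn)).
Variable X : nat -> 'M[F]_n.

Definition qeval (a : Q) : 'M[F]_n := eeval nn X (rep a).

Lemma qeval_cls u : qeval (cls nn (MCH_gens nn) u) = eeval nn X u.
Proof. exact/etrel_eeval/rep_cls. Qed.

Lemma qevalD a b : qeval (a + b) = qeval a + qeval b.
Proof. exact: qeval_cls. Qed.

Lemma qevalM a b : qeval (a * b) = qeval a *m qeval b.
Proof. exact: qeval_cls. Qed.

Lemma qeval0 : qeval 0 = 0.
Proof. by rewrite [LHS]qeval_cls /= raddf0. Qed.

Lemma qeval1 : qeval 1 = 1%:M.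
Proof. exact: qeval_cls. Qed.

Lemma qeval_tr a : qeval (qtr a) = (\tr (qeval a))%:M.
Proof. exact: qeval_cls. Qed.

Lemma qeval_word w : qeval (qword nn _ w) =
  tword (M := mx_trace_monoid F n) (mx_letter X) w.
Proof.
rewrite /qword; elim: w => [|l w IH] /=; first by rewrite big_nil qeval1.
by rewrite big_cons qevalM IH /qletter !qevalM !qeval_cls.
Qed.

Lemma qeval_traces ws : qeval (qtraces nn _ ws) =
  (\prod_(w <- ws) ttr (tword (M := mx_trace_monoid F n) (mx_letter X) w))%:M.
Proof.
rewrite /qtraces; elim: ws => [|w ws IH]; first by rewrite !big_nil qeval1.
by rewrite !big_cons qevalM IH qeval_tr qeval_word -scalar_mxM.
Qed.

End Evaluation.

Section DualScalars.
Variables (F : fieldType) (t : nat) (nn : 'I_t -> nat) (G : etm F t -> Prop).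
Local Notation Q := (etquot nn G).

Lemma qconst_in_center c : central (qconst nn G c).
Proof. exact/centralP/qconst_central. Qed.

Definition dual_const (c : F) : dual Q := (Center (qconst_in_center c), 0).

Lemma dual_const_additive : {morph dual_const : c d / c - d}.
Proof.
move=> c d; congr pair; last by rewrite subr0.
apply/val_inj; rewrite /= qconstD; congr (_ + _).
by rewrite -mulN1r qconstM qconstN1 mulN1r.
Qed.

Lemma dual_const_multiplicative : GRing.monoid_morphism dual_const.
Proof.
split=> [|c d]; first by congr pair; apply/val_inj.
rewrite dual_mulE /= !mulr0 addr0; congr pair; apply/val_inj.
exact: qconstM.
Qed.

HB.instance Definition _ :=
  GRing.isZmodMorphism.Build F (dual Q) dual_const dual_const_additive.
HB.instance Definition _ :=
  GRing.isMonoidMorphism.Build F (dual Q) dual_const dual_const_multiplicative.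

End DualScalars.

Section Completeness.
Variables (F : fieldType) (t : nat) (nn : 'I_t -> nat).
Local Notation n := (bsum nn).
Local Notation Q := (etquot nn (@MCH_gens F t nn)).
Local Notation tr := (@qtr F t nn (MCH_gens nn)).
Local Notation e := (@qidem F t nn (MCH_gens nn)).
Local Notation M := (@quotient_monoid F t nn).

Lemma quotient_ortho a b (r : M) : a != b ->
  ttr (tmul (tmul (Pure (e a) : M) (Pure (e b) : M)) r) = 0.
Proof.
move=> /negPf ab; case: r => [c|u v|] //=; rewrite qidemM ab mul0r.
  by congr pair; apply/val_inj; rewrite /= qtr0.
by congr pair; rewrite mulr0.
Qed.

Variable N : nat.

(** The variable [N] plays the marker: E_a x_N E_b becomes the marked word with [e a] before the
    marker and [e b] after it. *)
Definition marked_letter (l : letter t) : M :=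
  if l.1.1 == N then Mark (e l.1.2) (e l.2) else Pure (qletter nn _ l).

Lemma marked_letter_left l : tmul (Pure (e l.1.2) : M) (marked_letter l) = marked_letter l.
Proof.
rewrite /marked_letter; case: eqP => _ /=; first by rewrite qidem_idem.
by rewrite qletter_left eqxx.
Qed.

Lemma marked_letter_right l : tmul (marked_letter l) (Pure (e l.2) : M) = marked_letter l.
Proof.
rewrite /marked_letter; case: eqP => _ /=; first by rewrite qidem_idem.
by rewrite qletter_right eqxx.
Qed.

Lemma tword_unmarked w : {in w, forall l, l.1.1 != N} ->
  tword marked_letter w = Pure (qword nn _ w).
Proof.
rewrite /qword; elim: w => [|l w IH] wN /=; first by rewrite big_nil.
rewrite IH => [|l' l'w]; last by apply: wN; rewrite inE l'w orbT.
by rewrite big_cons /marked_letter (negPf (wN l _)) // mem_head.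
Qed.

Lemma prod_unmarked ws : {in flatten ws, forall l, l.1.1 != N} ->
  exists2 c : center Q, \prod_(w <- ws) ttr (tword marked_letter w) = (c, 0) &
    center_val c = qtraces nn _ ws.
Proof.
rewrite /qtraces; elim: ws => [|w ws IH] wN /=.
  by exists 1; rewrite !big_nil.
have [|c E cE] := IH; first by move=> l lw; apply: wN; rewrite mem_cat lw orbT.
rewrite !big_cons E tword_unmarked; last first.
  by move=> l lw; apply: wN; rewrite mem_cat lw.
eexists; first by rewrite dual_mulE /= mulr0 mulr0 addr0.
by rewrite /= cE.
Qed.

End Completeness.

(** For a fresh variable [N], tr(e_p f e_q X_N) is a pure identity in which X_N occurs once in each
    monomial. [polarization] carries it over to marked words of the quotient, where its eps part is
    the class of e_p f e_q. *)
Lemma identity_in_ideal (F : fieldType) (F0 : [pchar F] =i pred0) (t : nat)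
    (nn : 'I_t -> nat) (f : etm F t) (p q : 'I_t) :
  is_Etrace_identity nn f ->
  qidem nn (MCH_gens nn) p * cls nn (MCH_gens nn) f * qidem nn (MCH_gens nn) q = 0.
Proof.
move=> fid; have [K [Kw KE]] := normal_form_exists nn (@MCH_gens F t nn) f p q.
pose letters (k : F * (seq (letter t) * seq (seq (letter t)))) := k.2.1 ++ flatten k.2.2.
pose N := (\max_(k <- K) \max_(l <- letters k) l.1.1).+1.
have ltN k l : k \in K -> l \in letters k -> l.1.1 != N.
  move=> kK lk; rewrite neq_ltn ltnS; apply/orP; left.
  apply: leq_trans (@leq_bigmax_seq _ K xpredT (fun k => \max_(l <- letters k) l.1.1)%N k kK isT).
  exact: (@leq_bigmax_seq _ _ xpredT (fun l => l.1.1)).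
(* The idempotents are swapped because [mk] closes up a word that begins with [e p] and ends with
   [e q]. *)
pose mk : letter t := (N, q, p).
pose K' := [seq (k.1, (mk :: k.2.1) :: k.2.2) | k <- K].
have K'w k : k \in K' -> all (fun w => 0 < size w)%N k.2.
  by case/mapP=> k' k'K -> /=; apply: Kw.
have K'id X : \sum_(k <- K') k.1 *
    \prod_(w <- k.2) ttr (tword (M := mx_trace_monoid F (bsum nn)) (mx_letter X) w) = 0.
  have : \tr (qeval X (qidem nn _ p * cls nn (MCH_gens nn) f * qidem nn _ q) *m X N) = 0.
    by rewrite !qevalM qeval_cls fid mulmx0 !mul0mx raddf0.
  rewrite KE (big_morph (qeval X) (qevalD X) (qeval0 X)) mulmx_suml raddf_sum => E.
  rewrite -[RHS]E big_map; apply: eq_bigr => k _; rewrite big_cons /qmono !qevalM.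
  rewrite qeval_traces qeval_word !qeval_cls /= !mul_scalar_mx -!scalemxAl !mxtraceZ.
  congr (_ * _); rewrite mulrC; congr (_ * _).
  by rewrite -[_ *m X N]mulmxA [RHS]mxtrace_mulC /mx_letter /= !mulmxA.
have pureM (u v : quotient_monoid F nn) : is_pure u -> is_pure v -> is_pure (tmul u v).
  by case: u; case: v.
have adm k : k \in K' -> exists j0, forall j, (j < size (flatten k.2))%N -> j != j0 ->
    is_pure (@marked_letter F t nn N (nth mk (flatten k.2) j)).
  case/mapP=> k' k'K ->; exists 0%N => -[|j] //= jlt _.
  by rewrite /marked_letter (negPf (ltN _ _ k'K _)) // mem_nth.
have := @polarization F F0 t nn mk K' K'w K'id _ (@dual_const F t nn (MCH_gens nn))
  (quotient_monoid F nn) (fun a => Pure (qidem nn _ a)) (@is_pure _) pureM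
  (@quotient_ortho F t nn) (@quotient_alt0 F t nn) (@marked_letter F t nn N)
  (@marked_letter_left F t nn N) (@marked_letter_right F t nn N) adm.
rewrite big_map KE => /(congr1 snd); rewrite (raddf_sum (@snd (center _) _)) => H.
apply: etrans H; apply: eq_big_seq => k kK /=; rewrite big_cons.
rewrite [tword _ (mk :: _)]/=; have [|c -> cE] := @prod_unmarked F t nn N k.2.2.
  by move=> l lk; apply: (ltN k) => //; rewrite mem_cat lk orbT.
rewrite tword_unmarked => [|l lk]; last by apply: (ltN k) => //; rewrite mem_cat lk.
by rewrite /marked_letter eqxx /= !mulr0 addr0 add0r /qmono cE.
Qed.

Theorem theorem2p6 (F : fieldType) (hF : [pchar F] =i pred0)
  (t : nat) (nn : 'I_t -> nat) (f : etm F t) :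
  is_Etrace_identity nn f <-> etrel nn (MCH_gens nn) f EZero.
Proof.
split=> [fid|/etrel_eeval rel v]; last by rewrite rel /= raddf0.
(* Peirce decomposition of [f] into its corners. *)
apply/clsP; rewrite -[LHS]mul1r -[LHS]mulr1 -(qidem_sum nn (MCH_gens nn)).
rewrite mulr_suml mulr_suml big1 // => p _; rewrite mulr_sumr big1 // => q _.
exact: identity_in_ideal.
Qed.
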